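(* (a) $K1/N1$ has a basis adapted to $T_7$ and $T_{13}$ with $m_{0,0}$ the class of $F$. (b) $K5/N1$ has a basis adapted to $T_7$ and $T_{13}$ with $m_{0,0}$ the class of $F^2G$.
   Context: $\mathbb{Z}/2[[x]]$ is the formal power series ring over the field with two elements. Let $r=\sum_{n>0}(x^{n^2}+x^{2n^2}+x^{3n^2}+x^{6n^2})$, $\mathbb{Z}/2[r]\subset\mathbb{Z}/2[[x]]$ the subring it generates, $F=r(r+1)^3$, $G=r^3(r+1)$. Let $K1$, $K5$, $N1$ be the free $\mathbb{Z}/2[G^2]$-submodules of $\mathbb{Z}/2[r]$ with bases $\{G,F\}$, $\{G,F^2G\}$, $\{G\}$ respectively. For primes $p>3$, $T_p(\sum a_nx^n)=\sum a_{pn}x^n+\sum a_nx^{pn}$; $T_7$ and $T_{13}$ map $K1$, $K5$ and $N1$ into themselves, hence act on $K1/N1$ and $K5/N1$. A basis of a $\mathbb{Z}/2$-vector space $V$ adapted to commuting operators $X,Y$ is a $\mathbb{Z}/2$-basis $\{m_{i,j}\}_{i,j\ge 0}$ with $Xm_{i,j}=m_{i-1,j}$ for $i>0$, $Xm_{0,j}=0$, $Ym_{i,j}=m_{i,j-1}$ for $j>0$, $Ym_{i,0}=0$. *)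

(* Defs.v *)
From HB Require Import structures.
From mathcomp Require Import all_boot all_order all_algebra.
From mathcomp Require Import generic_quotient ring_quotient.
From mathcomp Require Import boolp.

Set Implicit Arguments.
Unset Strict Implicit.
Unset Printing Implicit Defensive.

Import GRing.Theory.
Local Open Scope ring_scope.
Local Open Scope quotient_scope.

(* Formal power series R[[x]]; f n is the coefficient of x^n in f. *)
Record fps (R : Type) := FPS { fps_coef :> nat -> R }.

Lemma fpsP (R : Type) (f g : fps R) : (forall n, f n = g n) -> f = g.
Proof. by case: f g => [f] [g] /= fg; congr FPS; apply/funext. Qed.

HB.instance Definition _ (R : Type) := gen_eqMixin (fps R).
HB.instance Definition _ (R : Type) := gen_choiceMixin (fps R).

Section FpsZmodule.
Variable R : zmodType.
Implicit Types f g h : fps R.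

Definition fps_zero : fps R := FPS (fun=> 0).
Definition fps_opp f : fps R := FPS (fun n => - f n).
Definition fps_add f g : fps R := FPS (fun n => f n + g n).

Lemma fps_addA : associative fps_add.
Proof. by move=> f g h; apply: fpsP => n /=; rewrite addrA. Qed.
Lemma fps_addC : commutative fps_add.
Proof. by move=> f g; apply: fpsP => n /=; rewrite addrC. Qed.
Lemma fps_add0 : left_id fps_zero fps_add.
Proof. by move=> f; apply: fpsP => n /=; rewrite add0r. Qed.
Lemma fps_addN : left_inverse fps_zero fps_opp fps_add.
Proof. by move=> f; apply: fpsP => n /=; rewrite addNr. Qed.

HB.instance Definition _ :=
  GRing.isZmodule.Build (fps R) fps_addA fps_addC fps_add0 fps_addN.
End FpsZmodule.

Section FpsAlgebra.
Variable R : comNzRingType.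
Implicit Types f g h : fps R.

Definition fps_one : fps R := FPS (fun n => (n == 0)%:R).
Definition fps_mul f g : fps R :=
  FPS (fun n => \sum_(i < n.+1) f i * g (n - i)%N).
Definition fps_scale (c : R) f : fps R := FPS (fun n => c * f n).

Lemma fps_mul_poly N f g n : (n < N)%N ->
  fps_mul f g n = ((\poly_(i < N) f i) * (\poly_(i < N) g i))`_n.
Proof.
move=> nN; rewrite coefM /=; apply: eq_bigr => i _; rewrite !coef_poly.
rewrite (leq_ltn_trans _ nN) ?(leq_ltn_trans _ nN) ?leq_subr //.
by rewrite -ltnS.
Qed.

Lemma fps_mulA : associative fps_mul.
Proof.
move=> f g h; apply: fpsP => n.
have E u v : forall i, (i < n.+1)%N -> (\poly_(i < n.+1) fps_mul u v i)`_i =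
    ((\poly_(i < n.+1) u i) * (\poly_(i < n.+1) v i))`_i.
  by move=> i lti; rewrite coef_poly lti; exact: fps_mul_poly.
rewrite !(@fps_mul_poly n.+1) // !coefM.
transitivity (((\poly_(i < n.+1) f i) *
   ((\poly_(i < n.+1) g i) * (\poly_(i < n.+1) h i)))`_n).
  by rewrite coefM; apply: eq_bigr => i _; rewrite E // ltnS leq_subr.
by rewrite mulrA coefM; apply: eq_bigr => i _; rewrite -E // ltn_ord.
Qed.
Lemma fps_mulC : commutative fps_mul.
Proof.
by move=> f g; apply: fpsP => n; rewrite !(@fps_mul_poly n.+1) // mulrC.
Qed.
Lemma fps_mul1 : left_id fps_one fps_mul.
Proof.
move=> f; apply: fpsP => n /=; rewrite big_ord_recl /= subn0 mul1r.
by rewrite big1 ?addr0 // => i _; rewrite mul0r.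
Qed.
Lemma fps_mulDl : left_distributive fps_mul +%R.
Proof.
move=> f g h; apply: fpsP => n /=; rewrite -big_split /=.
by apply: eq_bigr => i _; rewrite mulrDl.
Qed.
Lemma fps_one_neq0 : fps_one != 0.
Proof.
apply/eqP => /(congr1 (fun f : fps R => f 0%N)) /= /eqP.
by rewrite oner_eq0.
Qed.

HB.instance Definition _ := GRing.Zmodule_isComNzRing.Build (fps R)
  fps_mulA fps_mulC fps_mul1 fps_mulDl fps_one_neq0.

Lemma fps_scaleA a b f : fps_scale a (fps_scale b f) = fps_scale (a * b) f.
Proof. by apply: fpsP => n /=; rewrite mulrA. Qed.
Lemma fps_scale1 : left_id 1 fps_scale.
Proof. by move=> f; apply: fpsP => n /=; rewrite mul1r. Qed.
Lemma fps_scaleDr : right_distributive fps_scale +%R.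
Proof. by move=> a f g; apply: fpsP => n /=; rewrite mulrDr. Qed.
Lemma fps_scaleDl f : {morph fps_scale^~ f : a b / a + b}.
Proof. by move=> a b; apply: fpsP => n /=; rewrite mulrDl. Qed.

HB.instance Definition _ := GRing.Zmodule_isLmodule.Build R (fps R)
  fps_scaleA fps_scale1 fps_scaleDr fps_scaleDl.

Lemma fps_scaleAl (a : R) f g : a *: (f * g) = (a *: f) * g.
Proof.
apply: fpsP => n /=; rewrite mulr_sumr.
by apply: eq_bigr => i _; rewrite mulrA.
Qed.

HB.instance Definition _ :=
  GRing.Lmodule_isLalgebra.Build R (fps R) fps_scaleAl.
HB.instance Definition _ := GRing.Lalgebra_isComAlgebra.Build R (fps R).
End FpsAlgebra.

Section Quotients.
Variables (R : comNzRingType) (A : comAlgType R).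

(* The R[a]-submodule of A spanned by s; horner_alg a c is c.[a], so that R[a]
   is the range of horner_alg a. *)
Definition span_over (a : A) (s : seq A) : {pred A} :=
  fun f => `[< exists c : nat -> {poly R},
                 f = \sum_(i < size s) horner_alg a (c i) * s`_i >].

Lemma span_overP a s f :
  reflect (exists c : nat -> {poly R},
             f = \sum_(i < size s) horner_alg a (c i) * s`_i)
          (f \in span_over a s).
Proof. exact: asboolP. Qed.

Lemma mem_span_over a (s : seq A) f : f \in s -> f \in span_over a s.
Proof.
move=> fs; apply/span_overP.
exists (fun i => (i == index f s)%:R).
have lt : (index f s < size s)%N by rewrite index_mem.
rewrite (bigD1 (Ordinal lt)) // big1 => [|i].
  by rewrite rmorph_nat eqxx mul1r nth_index // [RHS]addr0.
by rewrite -val_eqE /= => /negPf ->; rewrite rmorph_nat mul0r.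
Qed.

Lemma span_over_submod a s : GRing.submod_closed (span_over a s).
Proof.
split.
  apply/span_overP; exists (fun=> 0).
  by rewrite big1 // => i _; rewrite rmorph0 mul0r.
move=> k _ _ /span_overP[c ->] /span_overP[d ->]; apply/span_overP.
exists (fun i => k *: c i + d i); rewrite scaler_sumr -big_split /=.
by apply: eq_bigr => i _; rewrite linearP /= mulr_algl mulrDl scalerAl.
Qed.

HB.instance Definition _ a s :=
  GRing.isSubmodClosed.Build R A (span_over a s)
    (span_over_submod a s).

Lemma span_over_sub a (s t : seq A) :
  {subset t <= s} -> {subset span_over a t <= span_over a s}.
Proof.
move=> ts _ /span_overP[c ->]; apply: rpred_sum => i _.
have /ts/mem_span_over-/(_ a)/span_overP[d ->] := mem_nth 0 (ltn_ord i).
apply/span_overP; exists (fun j => c i * d j); rewrite mulr_sumr.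
by apply: eq_bigr => j _; rewrite rmorphM mulrA.
Qed.

Definition smod (a : A) (s : seq A) := {f : A | f \in span_over a s}.

HB.instance Definition _ a s := SubChoice.on (smod a s).
HB.instance Definition _ a s :=
  [SubChoice_isSubLmodule of smod a s by <:].

Lemma smod_valB a s (u v : smod a s) : val (u - v) = val u - val v.
Proof. exact: raddfB. Qed.
Lemma smod_valZ a s k (u : smod a s) : val (k *: u) = k *: val u.
Proof. exact: linearZ. Qed.

(* The trace on smod a s of the submodule spanned by t; when t is included in
   the span of s, this is that submodule itself. *)
Definition sub_span (a : A) (s t : seq A) : {pred smod a s} :=
  fun u => val u \in span_over a t.

Lemma sub_span_submod a s t : GRing.submod_closed (@sub_span a s t).
Proof.
split=> [|k u v uW vW].
  by change (val (0 : smod a s) \in span_over a t); rewrite raddf0 rpred0.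
change (val (k *: u + v) \in span_over a t).
by rewrite linearP; apply: rpredD => //; apply: rpredZ.
Qed.

HB.instance Definition _ a s t :=
  GRing.isSubmodClosed.Build R (smod a s) (@sub_span a s t)
    (sub_span_submod a s t).

Definition qmod (a : A) (s t : seq A) := Quotient.quot (@sub_span a s t).

HB.instance Definition _ a s t := GRing.Zmodule.on (qmod a s t).

Section QuotientLmodule.
Variables (a : A) (s t : seq A).

Definition qclass (u : smod a s) : qmod a s t := \pi_(qmod a s t) u.

Lemma qclassP u v : qclass u = qclass v <-> val u - val v \in span_over a t.
Proof.
rewrite -smod_valB; change (qclass u = qclass v <-> u - v \in @sub_span a s t).
by rewrite Quotient.idealrBE; split=> /eqP.
Qed.

Definition qrepr (q : qmod a s t) : smod a s := repr q.

Lemma qreprK : cancel qrepr qclass.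
Proof. by move=> q; exact: reprK. Qed.

Lemma qclassD : {morph qclass : u v / u + v}.
Proof. by move=> u v; exact: Quotient.pi_add. Qed.

Definition qscale (k : R) (q : qmod a s t) := qclass (k *: qrepr q).

Lemma qscale_class k u : qscale k (qclass u) = qclass (k *: u).
Proof.
apply/qclassP; rewrite !smod_valZ -scalerBr rpredZ //.
by apply/qclassP; rewrite qreprK.
Qed.

Lemma qscaleA k l q : qscale k (qscale l q) = qscale (k * l) q.
Proof. by rewrite -[q]qreprK !qscale_class scalerA. Qed.
Lemma qscale1 : left_id 1 qscale.
Proof. by move=> q; rewrite -[q]qreprK qscale_class scale1r. Qed.
Lemma qscaleDr : right_distributive qscale +%R.
Proof.
move=> k q1 q2; rewrite -[q1]qreprK -[q2]qreprK -qclassD !qscale_class.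
by rewrite scalerDr qclassD.
Qed.
Lemma qscaleDl q : {morph qscale^~ q : k l / k + l}.
Proof.
by move=> k l; rewrite /= -[q]qreprK !qscale_class scalerDl qclassD.
Qed.

HB.instance Definition _ := GRing.Zmodule_isLmodule.Build R (qmod a s t)
  qscaleA qscale1 qscaleDr qscaleDl.

(* T maps the span of s into itself and X is the map it induces on the
   quotient. As X is a function of the class of u, T is compatible with
   congruence modulo the span of t. *)
Definition acts_as (T : A -> A) (X : qmod a s t -> qmod a s t) : Prop :=
  forall u : smod a s, exists2 v : smod a s,
    val v = T (val u) & X (qclass u) = qclass v.

End QuotientLmodule.
End Quotients.

Section Bases.
Variables (K : nzRingType) (V : lmodType K).

Definition is_basis (I : eqType) (b : I -> V) : Prop :=
  (forall (s : seq I) (c : I -> K), uniq s ->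
     \sum_(i <- s) c i *: b i = 0 -> {in s, forall i, c i = 0}) /\
  (forall v : V, exists (s : seq I) (c : I -> K),
     v = \sum_(i <- s) c i *: b i).

Definition adapted_basis (X Y : V -> V) (m : nat -> nat -> V) : Prop :=
  [/\ is_basis (fun ij : nat * nat => m ij.1 ij.2),
      (forall i j, X (m i.+1 j) = m i j),
      (forall j, X (m 0%N j) = 0),
      (forall i j, Y (m i j.+1) = m i j) &
      (forall i, Y (m i 0%N) = 0)].
End Bases.

(* The sum over n may be cut at n <= m, since n <= n^2. *)
Definition r : fps 'F_2 := FPS (fun m =>
  \sum_(1 <= n < m.+1) ((m == n ^ 2)%N%:R + (m == 2 * n ^ 2)%N%:R
                        + (m == 3 * n ^ 2)%N%:R + (m == 6 * n ^ 2)%N%:R)).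

Definition F : fps 'F_2 := r * (r + 1) ^+ 3.
Definition G : fps 'F_2 := r ^+ 3 * (r + 1).

Definition hecke (p : nat) (f : fps 'F_2) : fps 'F_2 :=
  FPS (fun n => f (p * n)%N + (if (p %| n)%N then f (n %/ p)%N else 0)).

(* Generators over Z/2[G^2] of the modules K1, K5 and N1. *)
Definition gK1 : seq (fps 'F_2) := [:: G; F].
Definition gK5 : seq (fps 'F_2) := [:: G; F ^+ 2 * G].
Definition gN1 : seq (fps 'F_2) := [:: G].

Lemma N1_sub_K1 : {subset span_over (G ^+ 2) gN1 <= span_over (G ^+ 2) gK1}.
Proof. by apply: span_over_sub => f; rewrite !inE => ->. Qed.

Lemma N1_sub_K5 : {subset span_over (G ^+ 2) gN1 <= span_over (G ^+ 2) gK5}.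
Proof. by apply: span_over_sub => f; rewrite !inE => ->. Qed.

Lemma F_in_K1 : F \in span_over (G ^+ 2) gK1.
Proof. by apply: mem_span_over; rewrite !inE eqxx orbT. Qed.

Lemma F2G_in_K5 : F ^+ 2 * G \in span_over (G ^+ 2) gK5.
Proof. by apply: mem_span_over; rewrite !inE eqxx orbT. Qed.

Definition K1modN1 : lmodType 'F_2 := qmod (G ^+ 2) gK1 gN1.
Definition K5modN1 : lmodType 'F_2 := qmod (G ^+ 2) gK5 gN1.

Definition classF : K1modN1 := qclass gN1 (Sub F F_in_K1 : smod (G ^+ 2) gK1).
Definition classF2G : K5modN1 :=
  qclass gN1 (Sub (F ^+ 2 * G) F2G_in_K5 : smod (G ^+ 2) gK5).

(* Main.v *)
(* Let D be the sum of the x^(m^2), m odd.  Then r + r^2 = D(x) + D(x^3), and an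
   involution on the pairs of odd (a, b) with a^2 + 3 b^2 = n gives
   D(x) D(x^3) = (D(x) + D(x^3))^4, whence F = D(x) and G = D(x^3).  This relation
   and a comparison of orders at x = 0 prove the modular equations between r(x)
   and r(x^p), and between t = G^2 and t(x^p), for p = 7 and 13.  In characteristic
   2, T_p f is the sum of the p + 1 conjugates of f, so Newton's identities compute
   T_p on powers of r, and the modular equation of t becomes a recurrence in k for
   T_p(g t^k), g = F, F^2 G or G.

   Modulo N1 this yields operators X, Y on Z/2[t] given by recurrent sequences of
   polynomials.  Taking fourth powers turns such a recurrence into a finite
   automaton reading the base 4 digits of k.  If [a, b] is the number with binary
   digits of a in even positions and those of b in odd positions, the automata show
   that X t^[a,b] = t^[a-1,b] and Y t^[a,b] = t^[a,b-1] up to terms of lower weight,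
   where [a, b] has weight 2 a + 3 b.  With lambda the coefficient of t^0, the
   functionals lambda X^i Y^j are therefore triangular with respect to the t^[a,b],
   and their dual basis is adapted to X and Y. *)

(* Two modular equations are needed because F, G and F^2 G are given as polynomials in r: Newton's
   identities on the equation of r yield the p + 1 initial values of T_p(g t^k), and the equation of
   t continues them. Leading terms are wanted for all k at once. This becomes a finite matter
   because the equation of t has coefficients in Z/2: the terms of index 4 k + c of a solution
   satisfy the same recurrence with t^4 for t, and so does t^e times the fourth power of any
   solution. Hence a solution splits, for each c and e, into solutions of the original recurrence,
   each fixed by its first p + 1 terms, and only finitely many occur. Fourth powers rather than
   squares: one base 4 digit holds a binary digit of a and one of b. The functional lambda is the
   coefficient of x^o, with o the order of g: 1 for F, 5 for F^2 G. It passes to the quotient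
   because N1 consists of series in x^3. Polynomials are coded as binary numbers to make the
   computations feasible; quotients and automata come from unproved searches, and only their
   outcomes are checked. *)
From Stdlib Require Import BinNat.
From HB Require Import structures.
Require Import Defs.
From mathcomp Require Import all_boot all_order all_algebra all_field.
From mathcomp Require Import zify ring.

Set Implicit Arguments.
Unset Strict Implicit.
Unset Printing Implicit Defensive.
Import GRing.Theory.
Local Open Scope ring_scope.

(** * Polynomials over Z/2 as binary numbers *)

Section EvalBits.
Variables (A : comNzRingType) (chA : forall a : A, a + a = 0).
Implicit Types (x y : A) (a b : N).

(* A number a : N stands for the polynomial over Z/2 whose coefficients are the
   binary digits of a; evN x a is its value at x. *)
Fixpoint evP x (p : positive) : A :=
  match p with
  | xH => 1
  | xO p => x * evP x p
  | xI p => 1 + x * evP x p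
  end.

Definition evN x a : A := if a is Npos p then evP x p else 0.

Lemma evN_double x a : evN x (N.double a) = x * evN x a.
Proof. by case: a => //=; rewrite mulr0. Qed.

Lemma evN_succ_double x a : evN x (N.succ_double a) = 1 + x * evN x a.
Proof. by case: a => //=; rewrite mulr0 addr0. Qed.

Lemma evN_lxor x a b : evN x (N.lxor a b) = evN x a + evN x b.
Proof.
case: a b => [|p] [|q]; rewrite ?add0r ?addr0 //=.
have D c : evN x (PosDef.Pos.Ndouble c) = x * evN x c by exact: evN_double.
have SD c : evN x (PosDef.Pos.Nsucc_double c) = 1 + x * evN x c.
  exact: evN_succ_double.
elim: p q => [p IH|p IH|] [q|q|] /=; rewrite ?D ?SD ?IH ?mulrDr.
- by rewrite addrACA chA add0r.
- by rewrite addrA.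
- by rewrite addrAC chA add0r.
- by rewrite addrCA.
- by [].
- by rewrite addrC.
- by rewrite addrA chA add0r.
- by [].
- by rewrite chA.
Qed.

Arguments N.lxor : simpl never.

Fixpoint mulP (p : positive) b : N :=
  match p with
  | xH => b
  | xO p => N.double (mulP p b)
  | xI p => N.lxor b (N.double (mulP p b))
  end.
Definition mulN a b : N := if a is Npos p then mulP p b else 0%num.

Lemma evN_mul x a b : evN x (mulN a b) = evN x a * evN x b.
Proof.
case: a => [|p]; first by rewrite mul0r.
elim: p => [p IH|p IH|] /=; rewrite ?evN_lxor ?evN_double ?IH ?mul1r //.
  by rewrite mulrDl mul1r mulrA.
by rewrite mulrA.
Qed.

Definition expN a n : N := iter n (mulN a) 1%num.

Lemma evN_exp x a n : evN x (expN a n) = evN x a ^+ n.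
Proof. by elim: n => //= n IH; rewrite evN_mul IH exprS. Qed.

Fixpoint compP (p : positive) b : N :=
  match p with
  | xH => 1%num
  | xO p => mulN b (compP p b)
  | xI p => N.lxor 1 (mulN b (compP p b))
  end.
Definition compN a b : N := if a is Npos p then compP p b else 0%num.

Lemma evN_comp x a b : evN x (compN a b) = evN (evN x b) a.
Proof.
case: a => [|p] //=.
by elim: p => [p IH|p IH|] //=; rewrite ?evN_lxor ?evN_mul ?IH.
Qed.

(** Squaring is additive in characteristic 2, so it only moves the digit at position i to position 2
    i. *)
Fixpoint sqP (p : positive) : positive :=
  match p with
  | xH => xH
  | xO p => xO (xO (sqP p))
  | xI p => xI (xO (sqP p))
  end.
Definition sqN a : N := if a is Npos p then Npos (sqP p) else 0%num.

Lemma evN_sq x a : evN x (sqN a) = evN x a ^+ 2.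
Proof.
case: a => [|p] /=; first by rewrite expr0n.
elim: p => [p IH|p IH|] /=; rewrite ?IH ?expr1n //.
  by rewrite sqrrD !mul1r mulr2n chA addr0 expr1n exprMn mulrA -expr2.
by rewrite exprMn mulrA -expr2.
Qed.

Fixpoint bitsP k (p : positive) : seq nat :=
  match p with
  | xH => [:: k]
  | xO p => bitsP k.+1 p
  | xI p => k :: bitsP k.+1 p
  end.
Definition bitsN a : seq nat := if a is Npos p then bitsP 0 p else [::].

Lemma evN_bits x a : evN x a = \sum_(i <- bitsN a) x ^+ i.
Proof.
case: a => [|p] /=; first by rewrite big_nil.
rewrite -[LHS]mul1r -[1](expr0 x); move: 0%N => k.
elim: p k => [p IH|p IH|] k /=; rewrite ?big_cons ?big_nil -?IH ?exprSr.
- by rewrite mulrDr mulr1 !mulrA.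
- by rewrite mulrA.
- by rewrite mulr1 addr0.
Qed.

Definition shlN a i : N := iter i N.double a.

Lemma evN_shl x a i : evN x (shlN a i) = x ^+ i * evN x a.
Proof.
elim: i => [|i IH]; first by rewrite mul1r.
by rewrite /= evN_double IH exprS mulrA.
Qed.

Definition sumN (s : seq N) : N := foldr N.lxor 0%num s.

Lemma evN_sum x s : evN x (sumN s) = \sum_(a <- s) evN x a.
Proof. by elim: s => [|a s IH]; rewrite ?big_nil // big_cons -IH -evN_lxor. Qed.

(* Polynomials in two variables X, Y: lists of coefficients in Y. *)
Definition ev2 x y (l : seq N) : A := foldr (fun a c => evN x a + y * c) 0 l.

Fixpoint add2 (l m : seq N) : seq N :=
  match l, m with
  | [::], _ => m
  | _, [::] => l
  | a :: l, b :: m => N.lxor a b :: add2 l m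
  end.

Lemma ev2_add x y l m : ev2 x y (add2 l m) = ev2 x y l + ev2 x y m.
Proof.
elim: l m => [|a l IH] [|b m] /=; rewrite ?add0r ?addr0 //.
by rewrite evN_lxor IH mulrDr addrACA.
Qed.

Definition scale2 a (l : seq N) := map (mulN a) l.

Lemma ev2_scale x y a l : ev2 x y (scale2 a l) = evN x a * ev2 x y l.
Proof.
elim: l => [|b l IH] /=; first by rewrite mulr0.
by rewrite evN_mul IH mulrDr mulrCA.
Qed.

Definition mul2 (l m : seq N) : seq N :=
  foldr (fun a c => add2 (scale2 a m) (0%num :: c)) [::] l.

Lemma ev2_mul x y l m : ev2 x y (mul2 l m) = ev2 x y l * ev2 x y m.
Proof.
elim: l => [|a l IH] /=; first by rewrite mul0r.
by rewrite ev2_add ev2_scale /= IH add0r mulrDl mulrA.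
Qed.

Fixpoint tensP a (p : positive) : seq N :=
  match p with
  | xH => [:: a]
  | xO p => 0%num :: tensP a p
  | xI p => a :: tensP a p
  end.
Definition tens a b : seq N := if b is Npos p then tensP a p else [::].

Lemma ev2_tens x y a b : ev2 x y (tens a b) = evN x a * evN y b.
Proof.
case: b => [|p] /=; first by rewrite mulr0.
elim: p => [p IH|p IH|] /=; rewrite ?IH ?mulr0 ?addr0 ?mulr1 ?add0r //.
  by rewrite mulrDr mulr1 mulrCA.
by rewrite mulrCA.
Qed.

Lemma ev2_zero x y l : all (pred1 0%num) l -> ev2 x y l = 0.
Proof. by elim: l => //= a l IH /andP[/eqP-> /IH->]; rewrite mulr0 addr0. Qed.

(* Polynomials in two variables as lists of monomials (i, j), for X^i Y^j. *)
Definition evM x y (l : seq (nat * nat)) : A := \sum_(m <- l) x ^+ m.1 * y ^+ m.2.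

Fixpoint monos2 k (l : seq N) : seq (nat * nat) :=
  if l is a :: l then [seq (i, k) | i <- bitsN a] ++ monos2 k.+1 l else [::].

Lemma ev2_monos x y l : ev2 x y l = evM x y (monos2 0 l).
Proof.
rewrite -[LHS]mul1r -[1](expr0 y) /evM; move: 0%N => k.
elim: l k => [|a l IH] k /=; first by rewrite big_nil mulr0.
rewrite big_cat /= -IH big_map mulrDr evN_bits mulr_sumr exprSr mulrA.
by congr (_ + _); apply: eq_bigr => i _; rewrite mulrC.
Qed.

Definition subst2 (l : seq (nat * nat)) a b : seq N :=
  foldr (fun m => add2 (tens (expN a m.1) (expN b m.2))) [::] l.

Lemma ev2_subst x y l a b :
  ev2 x y (subst2 l a b) = evM (evN x a) (evN y b) l.
Proof.
rewrite /evM; elim: l => [|m l IH] /=; first by rewrite big_nil.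
by rewrite big_cons ev2_add IH ev2_tens !evN_exp.
Qed.
End EvalBits.

Lemma rmorph_evN (A B : comNzRingType) (f : {rmorphism A -> B}) x a :
  f (evN x a) = evN (f x) a.
Proof.
case: a => [|p] /=; first by rewrite rmorph0.
by elim: p => [p IH|p IH|] /=; rewrite ?rmorphD ?rmorphM ?rmorph1 ?IH.
Qed.

Lemma rmorph_evM (A B : comNzRingType) (f : {rmorphism A -> B}) x y l :
  f (evM x y l) = evM (f x) (f y) l.
Proof.
by rewrite /evM rmorph_sum; apply: eq_bigr => m _; rewrite rmorphM !rmorphXn.
Qed.

(** * Power series *)

Section FpsMorphisms.
Variable R : comNzRingType.
Implicit Types f g : fps R.

Lemma fps_coefD f g n : (f + g) n = f n + g n. Proof. by []. Qed.
Lemma fps_coefB f g n : (f - g) n = f n - g n. Proof. by []. Qed.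
Lemma fps_coef0 n : (0 : fps R) n = 0. Proof. by []. Qed.
Lemma fps_coef1 n : (1 : fps R) n = (n == 0%N)%:R. Proof. by []. Qed.
Lemma fps_coefM f g n : (f * g) n = \sum_(i < n.+1) f i * g (n - i)%N.
Proof. by []. Qed.
Lemma fps_coef_sum I (s : seq I) (P : pred I) (f : I -> fps R) n :
  (\sum_(i <- s | P i) f i) n = \sum_(i <- s | P i) f i n.
Proof.
by apply: (big_morph (fun h : fps R => h n)) => [g h|]; rewrite ?fps_coefD.
Qed.

Definition fps_dil (z : R) f : fps R := FPS (fun n => z ^+ n * f n).

Lemma fps_dilE z f n : fps_dil z f n = z ^+ n * f n. Proof. by []. Qed.

Lemma fps_dil_is_zmod z : zmod_morphism (fps_dil z).
Proof. by move=> f g; apply: fpsP => n; rewrite /= mulrBr. Qed.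
Lemma fps_dil_is_monoid z : monoid_morphism (fps_dil z).
Proof.
split=> [|f g]; apply: fpsP => n; rewrite fps_dilE.
  by rewrite fps_coef1; case: n => [|n]; rewrite ?mulr1 ?mulr0.
rewrite !fps_coefM mulr_sumr; apply: eq_bigr => i _; rewrite !fps_dilE.
by rewrite mulrACA -exprD subnKC // -ltnS.
Qed.
HB.instance Definition _ z :=
  GRing.isZmodMorphism.Build (fps R) (fps R) (fps_dil z) (fps_dil_is_zmod z).
HB.instance Definition _ z :=
  GRing.isMonoidMorphism.Build (fps R) (fps R) (fps_dil z) (fps_dil_is_monoid z).

(* f(x^k); for k = 0 this is the constant term of f. *)
Definition fps_pow k f : fps R :=
  FPS (fun n => if (k %| n)%N then f (n %/ k)%N else 0).

Lemma fps_pow_coef k f n :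
  fps_pow k f n = if (k %| n)%N then f (n %/ k)%N else 0.
Proof. by []. Qed.

Lemma fps_pow_is_zmod k : zmod_morphism (fps_pow k).
Proof.
move=> f g; apply: fpsP => n; rewrite fps_coefB !fps_pow_coef.
by case: ifP; rewrite ?subr0.
Qed.
Lemma fps_pow_is_monoid k : monoid_morphism (fps_pow k).
Proof.
split=> [|f g]; apply: fpsP => n; rewrite fps_pow_coef.
  rewrite !fps_coef1; case: (posnP k) => [->|k_gt0].
    by rewrite dvd0n divn0 eqxx; case: eqP.
  case: (posnP n) => [->|n_gt0]; first by rewrite dvdn0 div0n.
  by case: ifP => // kn; rewrite gtn_eqF // divn_gt0 // dvdn_leq.
rewrite [RHS]fps_coefM; case: (posnP k) => [->|k_gt0].
  case: n => [|n]; first by rewrite fps_coefM !big_ord_recl !big_ord0.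
  rewrite dvd0n big1 // => i _; rewrite !fps_pow_coef !dvd0n.
  case: eqP => [->|]; last by rewrite mul0r.
  by rewrite subn0 mulr0.
have poly_pow h N m : (m < N)%N ->
    fps_pow k h m = ((\poly_(i < N) h i) \Po 'X^k)`_m.
  move=> mN; rewrite fps_pow_coef coef_comp_poly_Xn // coef_poly; case: ifP => // _.
  by rewrite (leq_ltn_trans (leq_div _ _) mN).
have -> : (if (k %| n)%N then (f * g) (n %/ k)%N else 0) =
    (((\poly_(i < n.+1) f i) * (\poly_(i < n.+1) g i)) \Po 'X^k)`_n.
  rewrite coef_comp_poly_Xn //; case: ifP => // _.
  by rewrite -fps_mul_poly // ltnS leq_div.
rewrite rmorphM coefM; apply: eq_bigr => i _.
by rewrite -!poly_pow // ltnS leq_subr.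
Qed.
HB.instance Definition _ k :=
  GRing.isZmodMorphism.Build (fps R) (fps R) (fps_pow k) (fps_pow_is_zmod k).
HB.instance Definition _ k :=
  GRing.isMonoidMorphism.Build (fps R) (fps R) (fps_pow k) (fps_pow_is_monoid k).

Lemma fps_powE k f n : (0 < k)%N -> fps_pow k f (k * n)%N = f n.
Proof. by move=> k_gt0; rewrite fps_pow_coef dvdn_mulr // mulKn. Qed.

Lemma fps_pow_inj k : (0 < k)%N -> injective (fps_pow k).
Proof.
move=> k_gt0 f g fg; apply: fpsP => n.
by rewrite -(fps_powE f n k_gt0) fg fps_powE.
Qed.

Lemma fps_powM j k f : (0 < j)%N -> (0 < k)%N ->
  fps_pow j (fps_pow k f) = fps_pow (j * k) f.
Proof.
move=> j_gt0 k_gt0; apply: fpsP => n; rewrite !fps_pow_coef.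
have [/dvdnP[m ->]|jn] := boolP (j %| n)%N.
  by rewrite mulnK // [(m * j)%N]mulnC dvdn_pmul2l // divnMl.
by case: ifP => // /(dvdn_trans (dvdn_mulr k (dvdnn j))); rewrite (negPf jn).
Qed.

Lemma fps_powC j k f : (0 < j)%N -> (0 < k)%N ->
  fps_pow j (fps_pow k f) = fps_pow k (fps_pow j f).
Proof. by move=> j_gt0 k_gt0; rewrite !fps_powM // mulnC. Qed.

(* f = c x^n + O(x^(n+1)), where c may be 0. *)
Definition lead n c f := (forall m, (m < n)%N -> f m = 0) /\ f n = c.

Lemma leadD n c d f g : lead n c f -> lead n d g -> lead n (c + d) (f + g).
Proof.
move=> [f0 <-] [g0 <-]; split=> // m mn.
by rewrite fps_coefD f0 // g0 // addr0.
Qed.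

Lemma leadM m n c d f g :
  lead m c f -> lead n d g -> lead (m + n) (c * d) (f * g).
Proof.
move=> [f0 <-] [g0 <-]; split=> [k kmn|].
  rewrite fps_coefM big1 // => i _; have [/f0->|mi] := ltnP i m.
    by rewrite mul0r.
  by rewrite g0 ?mulr0 //; move: (ltn_ord i); lia.
have lt : (m < (m + n).+1)%N by lia.
rewrite fps_coefM (bigD1 (Ordinal lt)) //= addKn big1 ?addr0 // => i.
rewrite -val_eqE /= => im; have [/f0->|mi] := ltnP i m; first by rewrite mul0r.
by rewrite g0 ?mulr0 //; move: (ltn_ord i); lia.
Qed.

Lemma lead1 : lead 0 1 (1 : fps R).
Proof. by split. Qed.

Lemma leadX m c f k : lead m c f -> lead (k * m) (c ^+ k) (f ^+ k).
Proof.
move=> fm; elim: k => [|k IH]; first exact: lead1.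
by rewrite !exprS mulSn; apply: leadM.
Qed.

Lemma lead_lt m n c f : (n < m)%N -> lead m c f -> lead n 0 f.
Proof. by move=> nm [f0 _]; split=> [k kn|]; apply: f0; lia. Qed.

Lemma lead_uniq m c d f : lead m c f -> lead m d f -> c = d.
Proof. by move=> [_ <-] [_ <-]. Qed.

Lemma lead_pow k n c f : (0 < k)%N -> lead n c f -> lead (k * n) c (fps_pow k f).
Proof.
move=> k_gt0 [f0 <-]; split=> [m mn|]; last exact: fps_powE.
rewrite fps_pow_coef; case: ifP => // _; apply: f0.
by rewrite ltn_divLR // mulnC.
Qed.

Lemma fps_lead f : f != 0 -> exists n, exists2 c, c != 0 & lead n c f.
Proof.
move=> nz; have ex : exists n, f n != 0.
  apply: boolp.contrapT => h; case/eqP: nz; apply: fpsP => n.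
  by apply/eqP; apply: boolp.contrapT => /negP fn; case: h; exists n.
exists (ex_minn ex); case: ex_minnP => n fn min; exists (f n) => //.
split=> // m mn; apply/eqP; apply: contraLR mn => fm.
by rewrite -leqNgt min.
Qed.

Lemma lead_sum n (s : seq (nat * nat)) p f g (c := \sum_(m <- s)
    if (m.1 + p * m.2 == n)%N then 1 else 0) :
  lead 1 1 f -> lead p 1 g -> all (fun m => n <= m.1 + p * m.2)%N s ->
  lead n c (evM f g s).
Proof.
rewrite {}/c => lf lg; elim: s => [|m s IH] /=.
  by move=> _; rewrite /evM !big_nil; split.
case/andP=> nm /IH {}IH; rewrite /evM !big_cons; apply: leadD => //.
have := leadM (leadX m.1 lf) (leadX m.2 lg).
rewrite muln1 !expr1n mulr1 [(m.2 * p)%N]mulnC.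
case: eqP => [->//|/eqP ne]; apply: lead_lt.
by rewrite ltn_neqAle eq_sym ne.
Qed.
End FpsMorphisms.

Section FpsMap.
Variables (R S : comNzRingType) (h : {rmorphism R -> S}).

Definition fps_map (f : fps R) : fps S := FPS (fun n => h (f n)).

Lemma fps_mapE f n : fps_map f n = h (f n). Proof. by []. Qed.

Lemma fps_map_is_zmod : zmod_morphism fps_map.
Proof.
by move=> f g; apply: fpsP => n; rewrite fps_coefB !fps_mapE fps_coefB rmorphB.
Qed.
Lemma fps_map_is_monoid : monoid_morphism fps_map.
Proof.
split=> [|f g]; apply: fpsP => n; first by rewrite fps_mapE !fps_coef1 rmorph_nat.
rewrite fps_mapE !fps_coefM rmorph_sum; apply: eq_bigr => i _.
by rewrite rmorphM.
Qed.
HB.instance Definition _ :=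
  GRing.isZmodMorphism.Build (fps R) (fps S) fps_map fps_map_is_zmod.
HB.instance Definition _ :=
  GRing.isMonoidMorphism.Build (fps R) (fps S) fps_map fps_map_is_monoid.
End FpsMap.

Lemma fps_domain (K : fieldType) (f g : fps K) : f * g = 0 -> (f == 0) || (g == 0).
Proof.
move=> fg; apply/negPn; rewrite negb_or; apply/negP => /andP[/fps_lead[m [c c0 fm]]].
case/fps_lead=> n [d d0 gn]; have := leadM fm gn; rewrite fg => -[_] /eqP.
by rewrite fps_coef0 eq_sym mulf_eq0 (negPf c0) (negPf d0).
Qed.

(** * Newton's identities in characteristic 2 *)

Section Newton.
Variable A : comNzRingType.
Implicit Types (a b : A) (P Q : {poly A}) (s : seq A).

(** The quotient of [P] by X - a as Horner's scheme yields it, in closed form. *)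
Definition quot_root P a : {poly A} :=
  \poly_(j < size P) \sum_(j.+1 <= i < size P) P`_i * a ^+ (i - j.+1).

Lemma coef_quot_root P a j :
  (quot_root P a)`_j = \sum_(j.+1 <= i < size P) P`_i * a ^+ (i - j.+1).
Proof. by rewrite coef_poly; case: ltnP => // jP; rewrite big_geq // leqW. Qed.

Lemma quot_rootP P a : root P a -> P = ('X - a%:P) * quot_root P a.
Proof.
move=> /rootP Pa; apply/polyP => j.
have rec k : (quot_root P a)`_k * a =
    \sum_(k.+1 <= i < size P) P`_i * a ^+ (i - k).
  rewrite coef_quot_root mulr_suml; apply: eq_big_nat => i /andP[ki _].
  by rewrite -mulrA -exprSr subnSK.
rewrite mulrBl coefB coefXM coefCM [a * _]mulrC rec.
case: j => [|j] /=.
  move: Pa; rewrite horner_coef -(big_mkord xpredT (fun i => P`_i * a ^+ i)).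
  case: (posnP (size P)) => [sP|sP].
    by rewrite sP !big_geq // subr0 nth_default ?sP.
  rewrite big_ltn // expr0 mulr1 => /eqP; rewrite addr_eq0 => /eqP->.
  by rewrite sub0r; congr (- _); apply: eq_bigr => i _; rewrite subn0.
rewrite coef_quot_root; case: (ltnP j.+1 (size P)) => jP.
  by rewrite (big_ltn jP) subnn expr0 mulr1 addrK.
by rewrite !big_geq ?subr0 ?nth_default // leqW.
Qed.

Lemma XsubC_mulI a : injective (fun Q => ('X - a%:P) * Q).
Proof.
by move=> Q1 Q2 /= eqQ; apply: (monic_lreg (monicXsubC a)).
Qed.

(** This is the logarithmic derivative, P'/P = sum of 1/(X - a). Quotients are compared after
    multiplication by X - a, which is monic and so cancellable over any ring. *)
Lemma deriv_prod_XsubC s (P := \prod_(a <- s) ('X - a%:P)) :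
  P^`() = \sum_(a <- s) quot_root P a.
Proof.
rewrite {}/P; elim: s => [|b s IH]; first by rewrite !big_nil derivC.
set R := \prod_(a <- s) _ in IH; rewrite !big_cons -/R derivM derivXsubC mul1r IH.
have rootM a : root R a -> root (('X - b%:P) * R) a.
  by move=> /rootP Ra; apply/rootP; rewrite hornerM Ra mulr0.
congr (_ + _).
  apply: (@XsubC_mulI b); apply: quot_rootP.
  by apply/rootP; rewrite hornerM hornerXsubC subrr mul0r.
rewrite mulr_sumr; apply: eq_big_seq => a /= sa; apply: (@XsubC_mulI a) => /=.
have Ra : root R a.
  by apply/rootP; rewrite /R (big_rem a) //= hornerM hornerXsubC subrr mul0r.
by rewrite -(quot_rootP (rootM _ Ra)) mulrCA -(quot_rootP Ra).
Qed.

(* The coefficient of X^(l-1) in [deriv_prod_XsubC]. *)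
Lemma newton_sums s l (P := \prod_(a <- s) ('X - a%:P)) : (0 < l)%N ->
  \sum_(l <= i < (size s).+1) P`_i * (\sum_(a <- s) a ^+ (i - l)) = P`_l *+ l.
Proof.
case: l => // l _; rewrite -coef_deriv deriv_prod_XsubC coef_sum.
under [RHS]eq_bigr => a _ do rewrite coef_quot_root.
rewrite exchange_big /= size_prod_XsubC; apply: eq_bigr => i _.
by rewrite mulr_sumr.
Qed.

Lemma prod_uniq_roots s P : (forall a b, a * b = 0 -> (a == 0) || (b == 0)) ->
  uniq s -> all (root P) s -> P \is monic -> size P = (size s).+1 ->
  P = \prod_(a <- s) ('X - a%:P).
Proof.
move=> dom; elim: s P => [|b s IH] P /=.
  move=> _ _ Pm /eqP/size_poly1P[c _ Pc]; rewrite big_nil.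
  by move: Pm; rewrite Pc monicE lead_coefC => /eqP->.
case/andP=> bs us /andP[/factor_theorem[Q PQ] rs] Pm sP; rewrite big_cons mulrC.
have Qm : Q \is monic by rewrite -(monicMr _ (monicXsubC b)) -PQ.
rewrite -(IH Q) //.
  apply/allP=> a sa; have /allP/(_ a sa)/rootP := rs.
  rewrite PQ hornerM hornerXsubC => /dom; rewrite subr_eq0 -rootE.
  by case/orP => // /eqP ab; rewrite -ab sa in bs.
apply: succn_inj; rewrite -sP PQ size_Mmonic ?monicXsubC ?monic_neq0 //.
by rewrite size_XsubC addn2.
Qed.
End Newton.

Section PowerSums.
Variables (A : comNzRingType) (chA : forall a : A, a + a = 0).
Variable dom : forall a b : A, a * b = 0 -> (a == 0) || (b == 0).
(* The polynomial is Z^n + sum over (i, j) in R of b^i Z^j. *)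
Variables (R : seq (nat * nat)) (n : nat).
Hypothesis (R_lt : all (fun m => m.2 < n)%N R) (n_even : ~~ odd n).

(** The second argument of [N.lxor] is the correction (n - k) c in Newton's identities, with c the
    coefficient of Z^(n - k); modulo 2 it survives only for odd n - k. As n is even, k = 0 gives
    none, so the leading coefficient, absent from [R], is never called for. *)
Definition newton_step (tbl : seq N) k : N :=
  N.lxor (sumN [seq shlN (nth 0%num tbl (m.2 + k - n)) m.1
                  | m <- R & (n <= m.2 + k)%N])
         (if (k < n)%N && odd (n - k) then
            sumN [seq shlN 1%num m.1 | m <- R & (m.2 + k == n)%N] else 0%num).

Fixpoint newton_tbl k : seq N :=
  if k is k.+1 then let tbl := newton_tbl k in rcons tbl (newton_step tbl k)
  else [::].

Variables (b : A) (s : seq A).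
Hypotheses (s_uniq : uniq s) (s_size : size s = n).
Hypothesis s_root : all (fun z => z ^+ n + evM b z R == 0) s.

Lemma size_newton_tbl k : size (newton_tbl k) = k.
Proof. by elim: k => //= k IH; rewrite size_rcons IH. Qed.

Let Q : {poly A} := \sum_(m <- R) b ^+ m.1 *: 'X^(m.2).
Let P : {poly A} := 'X^n + Q.

Let sizeQ : (size Q <= n)%N.
Proof.
apply: (leq_trans (size_sum _ _ _)); rewrite big_seq.
apply/bigmax_leqP_seq => m mR _.
apply: leq_trans (size_scale_leq (b ^+ m.1) 'X^(m.2)) _.
by rewrite size_polyXn; exact: (allP R_lt).
Qed.

Let PE : P = \prod_(a <- s) ('X - a%:P).
Proof.
have Q_lt : (size Q < size ('X^n : {poly A}))%N by rewrite size_polyXn ltnS.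
apply: (@prod_uniq_roots _ s P dom s_uniq).
- apply/allP => z /(allP s_root)/eqP z0; rewrite /root hornerD hornerXn.
  rewrite -[X in _ == X]z0 horner_sum; apply/eqP; congr (_ + _).
  by apply: eq_bigr => m _; rewrite hornerZ hornerXn.
- by rewrite monicE lead_coefDl // lead_coefXn.
- by rewrite size_polyDl // size_polyXn s_size.
Qed.

Lemma power_sums k i : (i < k)%N ->
  \sum_(z <- s) z ^+ i = evN b (nth 0%num (newton_tbl k) i).
Proof.
elim: k i => // k IH j; rewrite ltnS leq_eqVlt /= nth_rcons size_newton_tbl.
case: ltngtP => //= [ik _|-> _]; first exact: IH.
rewrite /newton_step (evN_lxor chA) evN_sum // big_map big_filter.
have termE (m : nat * nat) : m \in R -> (n <= m.2 + k)%N ->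
    evN b (shlN (nth 0%num (newton_tbl k) (m.2 + k - n)) m.1) =
    b ^+ m.1 * \sum_(z <- s) z ^+ (m.2 + k - n).
  move=> mR nm; rewrite evN_shl IH //; have /= := allP R_lt m mR; lia.
rewrite (_ : \sum_(m <- R | (n <= m.2 + k)%N) _ = \sum_(m <- R | (n <= m.2 + k)%N)
    b ^+ m.1 * \sum_(z <- s) z ^+ (m.2 + k - n)); last first.
  rewrite big_seq_cond [RHS]big_seq_cond; apply: eq_bigr => m /andP[].
  exact: termE.
have eq2 (x y : A) : x + y = 0 -> x = y.
  by move=> xy; rewrite -[x]addr0 -(chA y) addrA xy add0r.
(* For [n <= k], multiply the equation by z^(k - n) and sum over the roots z. Otherwise use Newton's
   identity at [n - k], whose term i = n is the power sum of exponent k. *)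
have [kn|nk] := ltnP k n; last first.
  rewrite addr0; apply: eq2; rewrite [X in _ + X](eq_bigl xpredT) => [|m]; last first.
    by rewrite (leq_trans nk) // leq_addl.
  transitivity (\sum_(z <- s) z ^+ (k - n) * (z ^+ n + evM b z R)); last first.
    by rewrite big_seq big1 // => z /(allP s_root)/eqP->; rewrite mulr0.
  under [RHS]eq_bigr => z _ do rewrite mulrDr -exprD subnK //.
  rewrite [RHS]big_split /=; congr (_ + _).
  under [RHS]eq_bigr => z _ do rewrite mulr_sumr.
  rewrite exchange_big /=; apply: eq_bigr => m _; rewrite mulr_sumr.
  apply: eq_bigr => z _; rewrite mulrCA -exprD; congr (_ * z ^+ _).
  by rewrite -addnBA // addnC.
have coefP i : P`_i = (i == n)%:R + \sum_(m <- R | (m.2 == i)%N) b ^+ m.1.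
  rewrite coefD coefXn; congr (_ + _); rewrite coef_sum [RHS]big_mkcond.
  apply: eq_bigr => m _; rewrite coefZ coefXn eq_sym.
  by case: eqP; rewrite ?mulr1 ?mulr0.
have charM (x : A) l : x *+ l = if odd l then x else 0.
  rewrite -{1}[l]odd_double_half -mul2n mulrnDr mulrnA [x *+ 2]chA mul0rn.
  by rewrite addr0; case: odd.
have nk : (0 < n - k)%N by rewrite subn_gt0.
have := newton_sums s nk; rewrite -PE s_size.
have Pn : P`_n = 1.
  rewrite coefP eqxx big_seq_cond big1 ?addr0 // => m /andP[mR /eqP mn].
  by have := allP R_lt m mR; rewrite /= mn ltnn.
rewrite big_nat_recr ?leq_subr //= subKn 1?ltnW // Pn mul1r => newton.
rewrite [X in _ = X + _](_ : _ = \sum_(n - k <= i < n)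
  P`_i * (\sum_(a <- s) a ^+ (i - (n - k)))); last first.
  transitivity (\sum_(n - k <= i < n) \sum_(m <- R)
      if i == m.2 then b ^+ m.1 * \sum_(z <- s) z ^+ (i - (n - k)) else 0).
    rewrite exchange_big /= big_mkcond; apply: eq_big_seq => m mR.
    rewrite -big_mkcond big_nat1_eq (allP R_lt m mR) andbT leq_subLR addnC.
    case: ifP => // nm; congr (_ * _).
    apply: eq_bigr => z _; congr (_ ^+ _); lia.
  apply: eq_big_nat => i /andP[_ ilt]; rewrite coefP (ltn_eqF ilt) add0r.
  rewrite mulr_suml [RHS]big_mkcond; apply: eq_bigr => m _.
  by rewrite eq_sym.
rewrite [X in _ = _ + X](_ : _ = P`_(n - k) *+ (n - k)).
  by rewrite -newton addrA chA add0r.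
rewrite charM coefP; case: ifP => // onk.
have -> : (n - k == n)%N = false.
  by apply: contraNF n_even => /eqP <-.
rewrite add0r evN_sum // big_map big_filter; apply: eq_big => [m|m _].
  by apply/eqP/eqP; lia.
by rewrite evN_shl /= mulr1.
Qed.
End PowerSums.

(** * Hecke operators as traces *)

Lemma F2_add (a : 'F_2) : a + a = 0.
Proof. by rewrite -mulr2n -mulr_natr pchar_Zp // mulr0. Qed.

Lemma char2_add (A : comNzRingType) (iota : {rmorphism 'F_2 -> A}) (a : A) : a + a = 0.
Proof. by rewrite -[a]mulr1 -mulrDr -(rmorph1 iota) -rmorphD F2_add rmorph0 mulr0. Qed.

Lemma polyF2_add (f : {poly 'F_2}) : f + f = 0.
Proof. by apply/polyP => i; rewrite coefD F2_add coef0. Qed.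

Lemma fps_char2 (A : comNzRingType) (chA : forall a : A, a + a = 0) (f : fps A) :
  f + f = 0.
Proof. by apply: fpsP => n; rewrite fps_coefD chA. Qed.

(** Take a root z of 1 + X + ... + X^(p-1) in an algebraic closure. At 1 this polynomial has the odd
    value p, so z is not 1 and, p being prime, has order p. *)
Lemma F2_unity_root p : prime p -> odd p ->
  exists (L : fieldType) (iota : {rmorphism 'F_2 -> L}) (z : L),
    z ^+ p = 1 /\ forall j, z ^+ j = 1 -> (p %| j)%N.
Proof.
move=> p_pr p_odd; have [L [iota _]] := countable_algebraic_closure 'F_2.
exists L, iota; have chL := char2_add iota.
have : size (\poly_(i < p) 1 : {poly L}) != 1.
  by rewrite size_poly_eq ?oner_eq0 // gtn_eqF ?prime_gt1.
case/closed_rootP => z /rootP zP; exists z.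
have z1 : z != 1.
  apply: contra_eq_neq zP => ->; rewrite horner_poly.
  under eq_bigr => i _ do rewrite expr1n mulr1.
  rewrite sumr_const card_ord -[p]odd_double_half p_odd -mul2n natrD natrM.
  by rewrite [2%:R]chL mul0r addr0 oner_eq0.
have zp : z ^+ p = 1.
  apply/eqP; rewrite -subr_eq0 subrX1; move: zP; rewrite horner_poly.
  by under eq_bigr => i _ do rewrite mul1r; move=> ->; rewrite mulr0.
split=> // j zj; apply: contraNT z1 => pj.
have := egcdnP p (_ : 0 < j)%N; case: (posnP j) pj => [->|j_gt0 pj /(_ isT)].
  by rewrite dvdn0.
case=> u v; rewrite (eqP (_ : gcdn j p == 1%N)) => [uv _|].
  have := congr1 (fun k => z ^+ k) uv.
  by rewrite /= mulnC exprM zj expr1n exprD mulnC exprM zp expr1n mul1r => ->.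
by rewrite gcdnC -/(coprime p j) prime_coprime.
Qed.

Section HeckeTrace.
Variables (p : nat) (p_pr : prime p) (p_odd : odd p).
Variables (L : fieldType) (emb : {rmorphism 'F_2 -> L}) (z : L).
Hypotheses (zp : z ^+ p = 1) (z_ord : forall j, z ^+ j = 1 -> (p %| j)%N).

Let p_gt0 : (0 < p)%N := prime_gt0 p_pr.

(* The conjugates f(z^k x^(1/p)) and f(x^p) of f, after replacing x by x^p. *)
Definition conjugate k : {rmorphism fps 'F_2 -> fps L} :=
  if (k < p)%N then (fps_dil (z ^+ k) \o fps_map emb : {rmorphism _ -> _})
  else (fps_pow (p * p) \o fps_map emb : {rmorphism _ -> _}).

(** Over x^p the conjugates, which involve x^(1/p), become power series in x. *)
Definition base_change : {rmorphism fps 'F_2 -> fps L} :=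
  (fps_pow p \o fps_map emb : {rmorphism fps 'F_2 -> fps L}).

Lemma base_change_inj : injective base_change.
Proof.
move=> f g /(fps_pow_inj p_gt0) fg; apply: fpsP => n.
apply: (fmorph_inj emb).
exact: (congr1 (fun h : fps L => h n) fg).
Qed.

Let chL : forall a : L, a + a = 0 := char2_add emb.

Let p_is_1 : p%:R = 1 :> L.
Proof.
rewrite -[p]odd_double_half p_odd -mul2n natrD natrM [2%:R]chL mul0r.
by rewrite addr0.
Qed.

Lemma sum_unity j : \sum_(k < p) (z ^+ k) ^+ j = (p %| j)%N%:R.
Proof.
under eq_bigr => k _ do rewrite exprAC.
have [/dvdnP[i ->]|pj] := boolP (p %| j)%N.
  under eq_bigr => k _ do rewrite mulnC exprM zp !expr1n.
  by rewrite sumr_const card_ord p_is_1.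
apply/eqP; have /eqP := subrX1 (z ^+ j) p.
rewrite exprAC zp expr1n subrr eq_sym mulf_eq0 subr_eq0 => /orP[/eqP/z_ord|//].
by rewrite (negPf pj).
Qed.

(** The p dilations add up to p times the terms of exponent divisible by p, and p is 1 in L because
    it is odd, so the usual division by p disappears. The last conjugate gives the second sum in
    T_p. *)
Lemma hecke_conjugates f :
  base_change (hecke p f) = \sum_(k < p.+1) conjugate k f.
Proof.
apply: fpsP => n; rewrite big_ord_recr fps_coefD fps_coef_sum.
rewrite {2}/conjugate ltnn; under eq_bigr => k _ do rewrite /conjugate /= ltn_ord.
transitivity (\sum_(k < p) (z ^+ k) ^+ n * emb (f n)
              + fps_pow (p * p) (fps_map emb f) n); last by [].
rewrite -mulr_suml sum_unity [base_change _]/= !fps_pow_coef.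
have [/dvdnP[m ->]|pn] := boolP (p %| n)%N; last first.
  rewrite mul0r; case: ifP => [ppn|_]; last by rewrite addr0.
  by rewrite (dvdn_trans (dvdn_mulr p (dvdnn p)) ppn) in pn.
rewrite mulnK // dvdn_pmul2r // divnMr // !fps_mapE /= rmorphD mul1r mulnC.
by congr (_ + _); case: ifP; rewrite ?fps_mapE // rmorph0.
Qed.

Lemma fps_map_pow k f : fps_map emb (fps_pow k f) = fps_pow k (fps_map emb f).
Proof.
apply: fpsP => n; rewrite fps_mapE !fps_pow_coef.
by case: ifP; rewrite ?rmorph0.
Qed.

(** For the last conjugate, substitute x^p for x in the relation. For [k < p], substitute z^k x,
    which fixes t(x^p), and exchange the two arguments by symmetry. *)
Lemma conjugate_rel t (l : seq (nat * nat)) k :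
  perm_eq l [seq (m.2, m.1) | m <- l] -> evM t (fps_pow p t) l = 0 ->
  evM (base_change t) (conjugate k t) l = 0.
Proof.
move=> sym tl; have evMC (x y : fps L) : evM x y l = evM y x l.
  rewrite /evM (perm_big _ sym) big_map; apply: eq_bigr => m _.
  by rewrite mulrC.
rewrite /conjugate; case: ifP => _; last first.
  have := congr1 base_change tl; rewrite rmorph_evM rmorph0 => tl'.
  by rewrite -[RHS]tl' /= fps_map_pow fps_powM.
have := congr1 (fps_dil (z ^+ k) \o fps_map emb : {rmorphism _ -> _}) tl.
rewrite rmorph_evM rmorph0 evMC => tl'; rewrite -[RHS]tl'.
congr (evM _ _ _); rewrite [LHS]/= [RHS]/= fps_map_pow; apply: fpsP => n.
rewrite fps_dilE fps_pow_coef; have [/dvdnP[m ->]|pn] := boolP (p %| n)%N.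
  by rewrite exprAC mulnC !exprM zp !expr1n mul1r.
by rewrite mulr0.
Qed.

Lemma evM_cons (A : comNzRingType) (x y : A) n l :
  evM x y ((0%N, n) :: l) = y ^+ n + evM x y l.
Proof. by rewrite /evM big_cons mul1r. Qed.

Section Relation.
Variables (l : seq (nat * nat)) (t : fps 'F_2).
Hypothesis l_sym : perm_eq ((0%N, p.+1) :: l) [seq (m.2, m.1) | m <- (0%N, p.+1) :: l].
Hypothesis t_rel : evM t (fps_pow p t) ((0%N, p.+1) :: l) = 0.

(** All conjugates of [t] are roots of one monic equation of degree p + 1 over Z/2[t]. Multiply it
    by the conjugate of f t^k and sum over the conjugates. *)
Lemma hecke_rec_aux f k :
  hecke p (f * t ^+ (k + p.+1)) =
  \sum_(m <- l) t ^+ m.1 * hecke p (f * t ^+ (k + m.2)).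
Proof.
apply: base_change_inj; rewrite rmorph_sum hecke_conjugates.
under [RHS]eq_bigr => m _ do
  rewrite rmorphM rmorphXn hecke_conjugates mulr_sumr.
rewrite exchange_big /=.
apply: eq_bigr => j _; rewrite rmorphM rmorphXn exprD.
have := conjugate_rel j l_sym t_rel; rewrite evM_cons => rel.
have -> : conjugate j t ^+ p.+1 = evM (base_change t) (conjugate j t) l.
  by rewrite -[LHS]addr0 -(fps_char2 chL (evM (base_change t) (conjugate j t) l))
    addrA rel add0r.
rewrite /evM !mulr_sumr; apply: eq_bigr => m _.
rewrite rmorphM rmorphXn exprD -[fps_pow p _]/(base_change t).
by rewrite [LHS]mulrA [LHS]mulrCA -!mulrA.
Qed.

Hypothesis l_lt : all (fun m => m.2 < p.+1)%N l.
Hypothesis t_lead : lead 1 1 t.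

(** The coefficients of x tell the conjugates apart: z^k for [k < p], and 0 for the last one, whose
    order is p^2. *)
Lemma conjugates_uniq : uniq [seq conjugate k t | k <- iota 0 p.+1].
Proof.
have emb_lead n c f : lead n c f -> lead n (emb c) (fps_map emb f).
  by move=> [f0 <-]; split=> // m /f0; rewrite fps_mapE => ->; rewrite rmorph0.
have leadE k : lead 1 (if (k < p)%N then z ^+ k else 0) (conjugate k t).
  rewrite /conjugate; case: ifP => _; last first.
    apply: (@lead_lt _ (p * p * 1) _ 1); last first.
      by rewrite -(rmorph1 emb); apply: lead_pow (emb_lead _ _ _ t_lead); lia.
    by have := prime_gt1 p_pr; lia.
  have [t0 t1] := emb_lead _ _ _ t_lead.
  split=> [m /t0 tm|]; rewrite [LHS](fps_dilE _ (fps_map emb t)).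
    by rewrite tm mulr0.
  by rewrite t1 rmorph1 mulr1 expr1.
have z_neq0 k : z ^+ k != 0.
  apply/expf_neq0/eqP => z0; have := oner_neq0 L.
  by rewrite -zp z0 expr0n gtn_eqF // eqxx.
rewrite map_inj_in_uniq ?iota_uniq // => i j; rewrite !mem_iota /= => ip jp cij.
have := leadE i; rewrite cij => /lead_uniq/(_ (leadE j)).
wlog ij : i j ip jp cij / (i <= j)%N.
  move=> H zij; have /orP[ij|ji] := leq_total i j; first exact: H.
  by apply/esym; apply: H.
case: (ltnP j p) => [jp'|pj].
  rewrite (leq_ltn_trans ij jp') => zij.
  have : z ^+ i * z ^+ (j - i) = z ^+ i * 1 by rewrite -exprD subnKC // mulr1.
  move/(mulfI (z_neq0 i))/z_ord.
  by have [//|/dvdn_leq H /H] := posnP (j - i)%N; lia.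
by case: ltnP => [_ /eqP|pi _]; [rewrite (negPf (z_neq0 i)) | lia].
Qed.

Lemma hecke_exp_aux K k : (k < K)%N ->
  hecke p (t ^+ k) = evN t (nth 0%num (newton_tbl l p.+1 K) k).
Proof.
move=> kK; apply: base_change_inj; rewrite rmorph_evN hecke_conjugates.
have dom (a b : fps L) : a * b = 0 -> (a == 0) || (b == 0) by exact: fps_domain.
rewrite -(power_sums (fps_char2 chL) dom l_lt _ conjugates_uniq) //.
- rewrite big_map -[iota 0 p.+1]/(index_iota 0 p.+1) big_mkord.
  by apply: eq_bigr => j _; rewrite rmorphXn.
- by rewrite /= p_odd.
- by rewrite size_map size_iota.
apply/allP => _ /mapP[j _ ->].
by rewrite -evM_cons (conjugate_rel j l_sym t_rel).
Qed.
End Relation.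
End HeckeTrace.

Section HeckeRelation.
Variables (p : nat) (p_pr : prime p) (p_odd : odd p).
Variables (l : seq (nat * nat)) (t : fps 'F_2).
Hypothesis l_sym :
  perm_eq ((0%N, p.+1) :: l) [seq (m.2, m.1) | m <- (0%N, p.+1) :: l].
Hypothesis t_rel : evM t (fps_pow p t) ((0%N, p.+1) :: l) = 0.

Lemma hecke_rec f k :
  hecke p (f * t ^+ (k + p.+1)) =
  \sum_(m <- l) t ^+ m.1 * hecke p (f * t ^+ (k + m.2)).
Proof.
have [L [emb [z [zp z_ord]]]] := F2_unity_root p_pr p_odd.
exact: (hecke_rec_aux p_pr p_odd emb zp z_ord).
Qed.

Lemma hecke_exp K k : all (fun m => m.2 < p.+1)%N l -> lead 1 1 t -> (k < K)%N ->
  hecke p (t ^+ k) = evN t (nth 0%num (newton_tbl l p.+1 K) k).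
Proof.
have [L [emb [z [zp z_ord]]]] := F2_unity_root p_pr p_odd.
move=> l_lt t_lead kK.
exact: (hecke_exp_aux p_pr p_odd emb zp z_ord l_sym t_rel l_lt t_lead kK).
Qed.
End HeckeRelation.

Lemma poly_F2_sq (q : {poly 'F_2}) : q ^+ 2 = q \Po 'X^2.
Proof.
have ch2 : 2%N \in [pchar {poly 'F_2}] by rewrite pchar_poly pchar_Fp.
rewrite -[q]coefK poly_def -(pFrobenius_autE ch2) !rmorph_sum /=; apply: eq_bigr => i _.
rewrite pFrobenius_autE exprZn linearZ /= comp_Xn_poly -exprM mulnC exprM.
congr (_ *: _); case: (q`_i) => [[|[|]]] // ? ; exact: val_inj.
Qed.

Lemma poly_F2_four (q : {poly 'F_2}) : q ^+ 4 = q \Po 'X^4.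
Proof.
have -> : 4%N = (2 * 2)%N by [].
by rewrite !exprM [LHS]poly_F2_sq (poly_F2_sq q) -comp_polyA comp_Xn_poly.
Qed.

Lemma fps_sq (f : fps 'F_2) : f ^+ 2 = fps_pow 2 f.
Proof.
apply: fpsP => n; rewrite [LHS](@fps_mul_poly _ n.+1) // -expr2 poly_F2_sq.
rewrite coef_comp_poly_Xn // coef_poly fps_pow_coef.
by case: ifP => // _; rewrite ltnS leq_div.
Qed.

Lemma fps_pow4 (f : fps 'F_2) : f ^+ 4 = fps_pow 4 f.
Proof. by rewrite (exprM f 2 2) !fps_sq fps_powM. Qed.

(** * The identity G(x) = F(x^3) *)

Lemma card_involution (T : finType) (A : {set T}) (f : T -> T) :
  {in A, forall x, f x \in A} -> {in A, forall x, f (f x) = x} ->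
  odd #|A| = odd #|[set x in A | f x == x]|.
Proof.
have [k] := ubnP #|A|; elim: k A => // k IH A Ak fA ff.
have [/existsP[x /andP[xA fx]]|] := boolP [exists x, (x \in A) && (f x != x)];
  last first.
  move=> /existsPn fix_all; congr (odd #|pred_of_set _|); apply/setP => x.
  rewrite !inE; have := fix_all x; rewrite negb_and negbK.
  by case: (x \in A).
pose B := A :\: [set x; f x].
have BA : B \subset A by apply: subsetDl.
have xfA : [set x; f x] \subset A.
  by apply/subsetP=> y; rewrite !inE => /orP[] /eqP->; rewrite ?fA.
have cardA : #|A| = #|B|.+2.
  rewrite -(cardsID [set x; f x] A) (setIidPr xfA) cards2 eq_sym fx.
  by rewrite addnC addn2.
rewrite cardA /= negbK (IH B).
- congr (odd #|pred_of_set _|); apply/setP=> y; rewrite !inE.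
  case: (eqVneq y x) => [->|yx]; first by rewrite (negPf fx) !andbF.
  case: (eqVneq y (f x)) => [->|] //=; rewrite ff // eq_sym (negPf fx).
  by rewrite !andbF.
- by rewrite -ltnS -cardA (leq_trans _ Ak) // cardA.
- move=> y; rewrite !inE negb_or => /andP[/andP[yx yfx] yA]; rewrite fA // andbT.
  rewrite negb_or; apply/andP; split.
    by apply: contra yfx => /eqP <-; rewrite ff.
  by apply: contra yx => /eqP fyx; rewrite -(ff y) // fyx ff.
- by move=> y yB; rewrite ff // (subsetP BA).
Qed.

Definition is_square m := (0 < m)%N && [exists i : 'I_m.+1, m == i ^ 2 :> nat]%N.

Lemma is_squareP m : reflect (exists2 i, 0 < i & m = i ^ 2)%N (is_square m).
Proof.
apply: (iffP andP) => [[m_gt0 /existsP[i /eqP mi]]|[i i_gt0 ->]].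
  by exists (nat_of_ord i) => //; move: m_gt0; rewrite {1}mi; case: (nat_of_ord i).
split; first by rewrite expn_gt0 i_gt0.
have ilt : (i < (i ^ 2).+1)%N by rewrite ltnS expnS expn1 leq_pmulr.
by apply/existsP; exists (Ordinal ilt).
Qed.

Lemma sum_square (P : pred nat) c m N : (0 < c)%N -> (m <= N)%N -> ~~ P 0%N ->
  \sum_(i < N.+1 | P i) (m == c * i ^ 2)%N%:R =
  [exists i : 'I_N.+1, P i && (m == c * i ^ 2)%N]%:R :> 'F_2.
Proof.
move=> c_gt0 mN P0; case: existsP => [[i /andP[Pi /eqP mi]]|nex].
  rewrite (bigD1 i) //= mi eqxx big1 ?addr0 // => j /andP[_ ji].
  rewrite eqn_pmul2l // eqn_exp2r //; case: eqP => // ij.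
  by case/eqP: ji; apply: val_inj.
rewrite big1 // => i Pi; case: eqP => // mi; case: nex; exists i.
by rewrite Pi mi eqxx.
Qed.

Definition squares : fps 'F_2 := FPS (fun m => (is_square m)%:R).
Definition odd_squares : fps 'F_2 := FPS (fun m => (odd m && is_square m)%:R).

Lemma squares_odd : squares = odd_squares + fps_pow 4 squares.
Proof.
apply: fpsP => m; rewrite fps_coefD fps_pow_coef /=.
have sqE :
    is_square m = odd m && is_square m || (4 %| m)%N && is_square (m %/ 4).
  apply/is_squareP/orP => [[i i_gt0 ->]|].
    have [oi|ei] := boolP (odd i).
      by left; rewrite oddX oi orbT; apply/is_squareP; exists i.
    right; rewrite -(even_halfK ei) -mul2n expnMn dvdn_mulr // mulKn //.
    by apply/is_squareP; exists i./2 => //; lia.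
  case=> /andP[h /is_squareP[i i_gt0 mi]]; first by exists i.
  by exists (2 * i)%N; rewrite ?muln_gt0 // expnMn -mi mulnC divnK.
rewrite [in LHS]sqE; have [m4|_] := boolP (4 %| m)%N; last by rewrite /= orbF addr0.
by have -> : odd m = false by [lia]; rewrite /= add0r.
Qed.

Lemma r_squares :
  r = squares + fps_pow 2 squares + fps_pow 3 squares + fps_pow 6 squares.
Proof.
apply: fpsP => m; rewrite !fps_coefD.
have sumE c : (0 < c)%N -> \sum_(1 <= n < m.+1) (m == c * n ^ 2)%N%:R =
    fps_pow c squares m :> 'F_2.
  move=> c_gt0; transitivity (\sum_(n < m.+1 | (0 < n)%N) (m == c * n ^ 2)%N%:R : 'F_2).
    rewrite -(big_mkord (fun n => 0 < n)%N (fun n => (m == c * n ^ 2)%N%:R)).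
    rewrite [RHS]big_ltn_cond //= [RHS]big_nat_cond [LHS]big_nat_cond.
    by apply: eq_bigl => -[|n]; rewrite ?andbT.
  rewrite sum_square // fps_pow_coef /=.
  have [/dvdnP[k ->]|cm] := boolP (c %| m)%N; last first.
    case: existsP => // -[i /andP[_ /eqP mi]].
    by rewrite {1}mi dvdn_mulr in cm.
  rewrite mulnK //; congr ((nat_of_bool _)%:R).
  apply/existsP/is_squareP => [[i]|[i i_gt0 ->]].
    case/andP=> i_gt0 /eqP kc; exists (nat_of_ord i) => //.
    by apply/eqP; rewrite -(eqn_pmul2l c_gt0) -kc mulnC.
  have ilt : (i < (i ^ 2 * c).+1)%N.
    by rewrite ltnS expnS expn1 -mulnA leq_pmulr // muln_gt0 i_gt0.
  by exists (Ordinal ilt); rewrite /= i_gt0 mulnC eqxx.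
have -> : squares m = fps_pow 1 squares m by rewrite fps_pow_coef dvd1n divn1.
rewrite -!sumE // -!big_split /=; apply: eq_bigr => n _.
by rewrite mul1n.
Qed.

(* With s = sqrt(-3), the element (a + b s)/2 of odd norm has exactly one
   associate c + d s in Z[s]; conjugating it gives this involution. *)
Definition eisenstein_flip (x : nat * nat) : nat * nat :=
  let: (a, b) := x in
  if a == b %[mod 4] then ((3 * b - a + (a - 3 * b)) %/ 2, (a + b) %/ 2)%N
  else ((a + 3 * b) %/ 2, (a - b + (b - a)) %/ 2)%N.
Arguments eisenstein_flip : simpl never.

Lemma flip_double a b : odd a -> odd b ->
  let: (c, d) := eisenstein_flip (a, b) in
  (a = b %[mod 4] /\ (2 * c = 3 * b - a + (a - 3 * b) /\ 2 * d = a + b) \/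
   a + b = 0 %[mod 4] /\ (2 * c = a + 3 * b /\ 2 * d = a - b + (b - a)))%N.
Proof.
move=> oa ob; rewrite /eisenstein_flip; case: eqP => ab; [left|right]; lia.
Qed.

Lemma flip_odd a b : odd a -> odd b ->
  odd (eisenstein_flip (a, b)).1 && odd (eisenstein_flip (a, b)).2.
Proof.
move=> oa ob; have := flip_double oa ob.
case: (eisenstein_flip _) => c d /=; lia.
Qed.

Lemma flip_norm a b : odd a -> odd b ->
  ((eisenstein_flip (a, b)).1 ^ 2 + 3 * (eisenstein_flip (a, b)).2 ^ 2 =
   a ^ 2 + 3 * b ^ 2)%N.
Proof.
move=> oa ob; have := flip_double oa ob.
case: (eisenstein_flip _) => c d /= flip; apply/eqP; rewrite -eqz_nat; apply/eqP.
rewrite -!mulnn !PoszD !PoszM.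
(* Solving for a and c in terms of b and d removes the halves, and the four sign cases remove the
   absolute values. *)
have : (a%:Z = d%:Z * 2 - b%:Z /\ c%:Z = b%:Z * 2 - d%:Z \/
    a%:Z = d%:Z * 2 - b%:Z /\ c%:Z = d%:Z - b%:Z * 2) \/
    (a%:Z = b%:Z + d%:Z * 2 /\ c%:Z = b%:Z * 2 + d%:Z \/
    a%:Z = b%:Z - d%:Z * 2 /\ c%:Z = b%:Z * 2 - d%:Z) by lia.
by case=> -[] [-> ->]; ring.
Qed.

Lemma flipK a b : odd a -> odd b -> eisenstein_flip (eisenstein_flip (a, b)) = (a, b).
Proof.
move=> oa ob; have := flip_double oa ob; have := flip_odd oa ob.
case: (eisenstein_flip (a, b)) => c d /= /andP[oc od].
have := flip_double oc od; case: (eisenstein_flip (c, d)) => e f h1 h2.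
by congr (_, _); lia.
Qed.

Lemma flip_fix a b : odd a -> odd b ->
  (eisenstein_flip (a, b) == (a, b)) = (a == b) || (a == 3 * b)%N.
Proof.
move=> oa ob; have := flip_double oa ob.
case: (eisenstein_flip (a, b)) => c d; rewrite xpair_eqE; lia.
Qed.

Lemma odd_squares_coef c m N : (0 < c)%N -> (m <= N)%N ->
  fps_pow c odd_squares m = \sum_(i < N.+1 | odd i) (m == c * i ^ 2)%N%:R.
Proof.
move=> c_gt0 mN; rewrite sum_square // fps_pow_coef /=.
have [/dvdnP[k mk]|cm] := boolP (c %| m)%N; last first.
  case: existsP => // -[i /andP[_ /eqP mi]].
  by rewrite mi dvdn_mulr in cm.
rewrite mk mulnK //; congr ((nat_of_bool _)%:R).
apply/andP/existsP => [[ok /is_squareP[i i_gt0 ki]]|[i /andP[oi kc]]].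
  have ilt : (i < N.+1)%N by rewrite ltnS (leq_trans _ mN) // mk ki; nia.
  exists (Ordinal ilt); rewrite /= ki mulnC eqxx andbT.
  by move: ok; rewrite ki oddX.
have ki : k = (i ^ 2)%N.
  by apply/eqP; rewrite -(eqn_pmul2l c_gt0) -(eqP kc) mulnC.
rewrite ki oddX oi; split=> //; apply/is_squareP; exists (nat_of_ord i) => //.
by case: (nat_of_ord i) oi.
Qed.

Lemma natr_odd_F2 k : k%:R = (odd k)%:R :> 'F_2.
Proof.
by rewrite -[k in LHS]odd_double_half -mul2n natrD natrM pchar_Zp // mul0r addr0.
Qed.

(* The coefficient of x^n counts the odd (a, b) with a^2 + 3 b^2 = n; modulo 2
   only the fixed points a = b and a = 3 b of the involution matter. *)
Lemma odd_squares_mul3 :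
  odd_squares * fps_pow 3 odd_squares =
  fps_pow 4 (odd_squares + fps_pow 3 odd_squares).
Proof.
rewrite rmorphD /= fps_powM //; apply: fpsP => n; rewrite fps_coefD.
rewrite !(@odd_squares_coef _ n n) // fps_coefM.
pose A := [set x : 'I_n.+1 * 'I_n.+1 |
  [&& odd x.1, odd x.2 & n == x.1 ^ 2 + 3 * x.2 ^ 2]%N].
transitivity (#|A|%:R : 'F_2).
  have D1 m : odd_squares m = fps_pow 1 odd_squares m.
    by rewrite fps_pow_coef dvd1n divn1.
  under eq_bigr => i _.
    rewrite D1 (@odd_squares_coef 1 i n) ?(@odd_squares_coef 3 _ n) ?leq_subr //;
      last by rewrite -ltnS.
    rewrite mulr_suml; under eq_bigr do rewrite mulr_sumr; over.
  rewrite exchange_big /=; under eq_bigr do rewrite exchange_big /=.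
  rewrite pair_big /= -sum1_card natr_sum.
  rewrite [RHS](eq_bigl (fun x : 'I_n.+1 * 'I_n.+1 =>
      (odd x.1 && odd x.2) && (n == x.1 ^ 2 + 3 * x.2 ^ 2)%N)); last first.
    by move=> x; rewrite inE andbA.
  rewrite [RHS]big_mkcondr; apply: eq_bigr => -[a b] /= _.
  under eq_bigr do rewrite -natrM mulnb mul1n.
  have [nab|nab] := eqVneq n (a ^ 2 + 3 * b ^ 2)%N.
    have lt : (a ^ 2 < n.+1)%N by rewrite ltnS {2}nab leq_addr.
    rewrite (bigD1 (Ordinal lt)) //= eqxx {1}nab addKn eqxx big1 ?addr0 // => i.
    by rewrite -val_eqE => /negPf /= ->.
  rewrite big1 // => i _; case: eqP => //= ia; case: eqP => // nb.
  by case/eqP: nab; rewrite -nb -ia subnKC // -ltnS.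
(* The flip preserves a^2 + 3 b^2 = n on [A], so its coordinates are at most n and [inord] does not
   alter them. *)
pose f (x : 'I_n.+1 * 'I_n.+1) : 'I_n.+1 * 'I_n.+1 :=
  let y := eisenstein_flip (val x.1, val x.2) in (inord y.1, inord y.2).
have fE x : x \in A -> (val (f x).1, val (f x).2) =
    eisenstein_flip (val x.1, val x.2).
  rewrite inE => /and3P[o1 o2 /eqP nx]; have nrm := flip_norm o1 o2.
  rewrite /f /= !inordK; first by case: eisenstein_flip.
    by move: nrm; rewrite -nx; case: eisenstein_flip => c d /=; nia.
  by move: nrm; rewrite -nx; case: eisenstein_flip => c d /=; nia.
have inj2 (x y : 'I_n.+1 * 'I_n.+1) : (val x.1, val x.2) = (val y.1, val y.2) -> x = y.
  by case: x y => [x1 x2] [y1 y2] [] /val_inj-> /val_inj->.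
have fA x : x \in A -> f x \in A.
  move=> xA; have := fE x xA; move: xA; rewrite !inE => /and3P[o1 o2 /eqP nx].
  move=> fx; have := flip_norm o1 o2; have := flip_odd o1 o2; rewrite -fx /=.
  by move=> /andP[-> ->] ->; rewrite -nx eqxx.
have ffK x : x \in A -> f (f x) = x.
  move=> xA; apply: inj2; rewrite fE ?fA // fE //.
  by move: xA; rewrite inE => /and3P[o1 o2 _]; rewrite flipK.
rewrite natr_odd_F2 (card_involution fA ffK) -natr_odd_F2 -sum1_card natr_sum.
(* Fixed points with a = b have n = 4 a^2, those with a = 3 b have n = 12 b^2; as b is odd, no pair
   is of both kinds. They yield the two series on the right. *)
transitivity (\sum_(x : 'I_n.+1 * 'I_n.+1 | odd x.1 && odd x.2)
   ((n == x.1 ^ 2 + 3 * x.2 ^ 2) && (x.1 == x.2) +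
    (n == x.1 ^ 2 + 3 * x.2 ^ 2) && (x.1 == 3 * x.2 :> nat))%N%:R : 'F_2).
  rewrite (eq_bigl (fun x : 'I_n.+1 * 'I_n.+1 => (odd x.1 && odd x.2) &&
      ((n == x.1 ^ 2 + 3 * x.2 ^ 2) && ((x.1 == x.2) || (x.1 == 3 * x.2 :> nat))))%N).
    rewrite big_mkcondr; apply: eq_bigr => -[a b] /= /andP[_ ob].
    case: (n == _) => //=; case: eqP => [->|_] /=; last by case: eqP.
    by case: eqP => //; move: ob; lia.
  move=> x; rewrite inE; have [xA|xA] := boolP (x \in A); last first.
    by move: xA; rewrite inE andbA !negb_and; case: odd; case: odd; case: eqP.
  have fxE : (f x == x) = (eisenstein_flip (val x.1, val x.2) == (val x.1, val x.2)).
    by rewrite -(fE x xA); apply/eqP/eqP => [->//|/inj2].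
  move: (xA); rewrite fxE inE => /and3P[o1 o2 nx].
  by rewrite flip_fix // o1 o2 nx -val_eqE.
under eq_bigr do rewrite natrD.
rewrite big_split /=; congr (_ + _).
  rewrite -(pair_big (fun a : 'I_n.+1 => odd a) (fun b : 'I_n.+1 => odd b)
    (fun a b => ((n == a ^ 2 + 3 * b ^ 2) && (a == b))%N%:R)) /=.
  apply: eq_bigr => a oa; rewrite (bigD1 a) //= eqxx andbT big1 ?addr0.
    by congr ((nat_of_bool (_ == _))%:R); lia.
  by move=> b /andP[_ /negPf ba]; rewrite [a == b]eq_sym ba andbF.
rewrite -(pair_big (fun a : 'I_n.+1 => odd a) (fun b : 'I_n.+1 => odd b)
    (fun a b => ((n == a ^ 2 + 3 * b ^ 2) && (a == 3 * b :> nat))%N%:R)) /=.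
rewrite exchange_big /=; apply: eq_bigr => b ob.
have [lt|nlt] := ltnP (3 * b) n.+1; last first.
  rewrite big1 => [|a _]; first by case: eqP => // nb; nia.
  by case: eqP => //= _; case: eqP => // ab; move: (ltn_ord a); lia.
rewrite (bigD1 (Ordinal lt)) /=; last by move: ob; lia.
rewrite eqxx andbT big1 ?addr0 => [|a /andP[_ ba]].
  by congr ((nat_of_bool (_ == _))%:R); lia.
by case: eqP => //= _; case: eqP => // ab; case/eqP: ba; apply: val_inj.
Qed.

Definition fps2 : forall f : fps 'F_2, f + f = 0 := fps_char2 F2_add.

(** Binary 11110, since r (r + 1)^3 = r + r^2 + r^3 + r^4 modulo 2; [Gbits] is 11000, for r^3 +
    r^4. *)
Definition Fbits : N := 30.
Definition Gbits : N := 24.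

Lemma F_bits : F = evN r Fbits.
Proof.
have r2 : r = evN r 2 by rewrite /= mulr1.
have r3 : r + 1 = evN r 3 by rewrite /= mulr1 addrC.
by rewrite /F {1}r2 r3 -(evN_exp fps2) -(evN_mul fps2).
Qed.

Lemma G_bits : G = evN r Gbits.
Proof.
have r2 : r = evN r 2 by rewrite /= mulr1.
have r3 : r + 1 = evN r 3 by rewrite /= mulr1 addrC.
by rewrite /G {1}r2 r3 -(evN_exp fps2) -(evN_mul fps2).
Qed.

Lemma r_lead : lead 1 1 r.
Proof.
have sq0 : squares 0%N = 0 by [].
have sq1 : squares 1%N = 1.
  rewrite /squares /=; have -> // : is_square 1.
  by apply/is_squareP; exists 1%N.
rewrite r_squares; split=> [[|//] _|]; rewrite !fps_coefD !fps_pow_coef.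
  by rewrite !div0n sq0 !addr0.
by rewrite sq1 !addr0.
Qed.

Lemma F_lead : lead 1 1 F.
Proof.
have r1 : lead 0 1 (r + 1).
  by rewrite -[X in lead _ X]add0r; apply: leadD (lead1 _); apply: lead_lt r_lead.
by have := leadM r_lead (leadX 3 r1); rewrite expr1n mul1r.
Qed.

Lemma G_lead : lead 3 1 G.
Proof.
have r1 : lead 0 1 (r + 1).
  by rewrite -[X in lead _ X]add0r; apply: leadD (lead1 _); apply: lead_lt r_lead.
by have := leadM (leadX 3 r_lead) r1; rewrite expr1n mul1r.
Qed.

(* D = odd_squares and F are both roots of Z^2 + u Z = u^4, with u = r + r^2. *)
Lemma F_pow3 : fps_pow 3 F = G.
Proof.
pose D := odd_squares; pose u := evN r 6.
have uE : u = D + fps_pow 3 D.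
  have -> : u = r + r ^+ 2 by rewrite /u /= mulr1 mulrDr mulr1 expr2.
  rewrite fps_sq r_squares !rmorphD /= !fps_powM //.
  have DE : D = squares + fps_pow 4 squares.
    by rewrite {1}squares_odd -addrA fps2 addr0.
  rewrite DE rmorphD /= fps_powM //.
  set s1 := squares; set s2 := fps_pow 2 s1; set s6 := fps_pow 6 s1.
  transitivity (s1 + fps_pow 4 s1 + (fps_pow 3 s1 + fps_pow 12 s1)
                + (s2 + s2) + (s6 + s6)); first by ring.
  by rewrite !fps2 !addr0.
have DE : D * (u + D) = u ^+ 4.
  by rewrite uE fps_pow4 -odd_squares_mul3 addrC addrA fps2 add0r.
have FE : F * (u + F) = u ^+ 4.
  by rewrite F_bits -(evN_lxor fps2) -(evN_mul fps2) -(evN_exp fps2).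
have /fps_domain/orP[] : (D + F) * (D + F + u) = 0.
  have -> : (D + F) * (D + F + u) = D * (u + D) + F * (u + F) + (D * F + D * F).
    by ring.
  by rewrite DE FE !fps2.
- move=> /eqP DF; have -> : F = D by rewrite -[LHS]add0r -DF -addrA fps2 addr0.
  have -> : fps_pow 3 D = u + D by rewrite uE addrC addrA fps2 add0r.
  have -> : D = F by rewrite -[RHS]addr0 -DF addrCA fps2 addr0.
  by rewrite F_bits G_bits /u -(evN_lxor fps2).
(* The other root is F + u = G, of order 3, whereas D starts with x. *)
move=> /eqP DFu; have DG : D = G.
  rewrite -[LHS]addr0 -(fps2 (F + u)) !addrA DFu add0r.
  by rewrite F_bits G_bits /u -(evN_lxor fps2).
have [G0 _] := G_lead; have /eqP := G0 1%N isT.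
by rewrite -DG /= ; have -> : is_square 1 by apply/is_squareP; exists 1%N.
Qed.

(** * Modular equations *)

Opaque r F G.

Lemma fps_pow_evM (A : comNzRingType) k (x y : fps A) l :
  fps_pow k (evM x y l) = evM (fps_pow k x) (fps_pow k y) l.
Proof. exact: (rmorph_evM (fps_pow k)). Qed.

Lemma fps_pow_mul (A : comNzRingType) k (x y : fps A) :
  fps_pow k (x * y) = fps_pow k x * fps_pow k y.
Proof. exact: rmorphM. Qed.

Lemma lead_ord (K : fieldType) m n (c d : K) (f : fps K) :
  c != 0 -> d != 0 -> lead m c f -> lead n d f -> m = n.
Proof.
move=> c0 d0 [fm0 fm] [fn0 fn]; case: (ltngtP m n) => // [/fn0|/fm0] E.
  by rewrite -fm E eqxx in c0.
by rewrite -fn E eqxx in d0.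
Qed.

Lemma lead_evM n (s : seq (nat * nat)) p (f g : fps 'F_2) :
  lead 1 1 f -> lead p 1 g -> all (fun m => n <= m.1 + p * m.2)%N s ->
  lead n (if odd (count (fun m => m.1 + p * m.2 == n)%N s) then 1 else 0) (evM f g s).
Proof.
move=> lf lg s_ge; have := lead_sum lf lg s_ge.
by rewrite -big_mkcond big_const_seq iter_addr addr0 natr_odd_F2; case: odd.
Qed.

(* Quotient by a polynomial that is monic in Y, on lists in which the
   coefficient of the highest power of Y comes first. *)
Fixpoint div_monic k (a b : seq N) : seq N :=
  if k is k.+1 then
    if a is q :: a then q :: div_monic k (add2 a (scale2 q b)) b else [::]
  else [::].
Definition quotY (a b : seq N) : seq N :=
  rev (div_monic (size a - size b).+1 (rev a) (behead (rev b))).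

Section ModularEquation.
Variables (p : nat) (R P : seq (nat * nat)).

Let Rd := subst2 R 2 2.
Definition modular_quot (b : N) : seq N := quotY (subst2 P b b) Rd.

(** The first two tests multiply the quotients back, so the division needs no proof. The others read
    orders in x: X^i Y^j has order i + p j at X = r(x), Y = r(x^p), and the parity of a count is the
    coefficient at the lowest order. *)
Definition modular_check : bool :=
  [&& all (pred1 0%num) (add2 (subst2 P Fbits Fbits) (mul2 Rd (modular_quot Fbits))),
      all (pred1 0%num) (add2 (subst2 P Gbits Gbits) (mul2 Rd (modular_quot Gbits))),
      odd (count (fun m => m.1 + p * m.2 == 0)%N (monos2 0 (modular_quot Fbits))),
      all (fun m => p.+1.*2 <= m.1 + p * m.2)%N (monos2 0 (modular_quot Gbits)),
      odd (count (fun m => m.1 + p * m.2 == p.+1.*2)%N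
             (monos2 0 (modular_quot Gbits))),
      all (fun m => p.+1 <= m.1 + p * m.2)%N R &
      ~~ odd (count (fun m => m.1 + p * m.2 == p.+1)%N R)].

Hypotheses (p_gt0 : (0 < p)%N) (ok : modular_check).

Let rp := fps_pow p r.

Lemma modular_factor b (f : fps 'F_2) : f = evN r b ->
  all (pred1 0%num) (add2 (subst2 P b b) (mul2 Rd (modular_quot b))) ->
  evM f (fps_pow p f) P = evM r rp R * ev2 r rp (modular_quot b).
Proof.
move=> fb /(ev2_zero r rp); rewrite ev2_add ?ev2_mul //; try exact: fps2.
rewrite !ev2_subst; try exact: fps2.
have x2 (x : fps 'F_2) : evN x 2 = x by rewrite /= mulr1.
rewrite !x2 -fb; have -> : evN rp b = fps_pow p f by rewrite fb rmorph_evN.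
by move=> fE; rewrite -[LHS]addr0 -(fps2 (evM r rp R * ev2 r rp (modular_quot b)))
  addrA fE add0r.
Qed.

(* With e = R(r(x), r(x^p)), the identity F(x^3) = G(x) gives
   e(x^3) q(x^3) = e(x) q'(x), where q is a unit and q' has order 2(p+1).  So e
   would have order p + 1, but its coefficient of x^(p+1) vanishes. *)
Lemma modular_r : evM r rp R = 0.
Proof.
case/and5P: ok => okF okG cF aG /and3P[cG aR cR].
have lrp : lead p 1 rp by rewrite -[p]muln1; apply: lead_pow r_lead.
have le : lead p.+1 0 (evM r rp R).
  by have := lead_evM r_lead lrp aR; rewrite (negPf cR).
have := modular_factor F_bits okF; have := modular_factor G_bits okG.
rewrite !ev2_monos; move: (monos2 _ _) aG cG => Q' aG cG eG.
move: (monos2 _ _) cF => Q cF eF.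
have lq : lead 0 1 (evM r rp Q).
  have := @lead_evM 0 Q p r rp r_lead lrp; rewrite cF; apply.
  by apply/allP.
have lq' : lead p.+1.*2 1 (evM r rp Q').
  by have := lead_evM r_lead lrp aG; rewrite cG.
move: (evM r rp R) le eG eF => e le eG eF.
have eqe : fps_pow 3 e * fps_pow 3 (evM r rp Q) = e * evM r rp Q'.
  rewrite -fps_pow_mul -eF -eG fps_pow_evM.
  by rewrite (fps_powC F (isT : 0 < 3)%N p_gt0) F_pow3.
apply/eqP; apply: contraT => /fps_lead[m [c c0 lem]].
have := leadM (lead_pow (isT : 0 < 3)%N lem) (lead_pow (isT : 0 < 3)%N lq).
have := leadM lem lq'; rewrite -eqe mulr1 muln0 addn0 => l1 l2.
have mp : m = p.+1.
  have {l1 l2} := lead_ord c0 c0 l1 l2; rewrite -[X in (_ + X)%N]mul2n.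
  by clear; lia.
by rewrite mp in lem; rewrite (lead_uniq lem le) eqxx in c0.
Qed.

Lemma modular_G : evM G (fps_pow p G) P = 0.
Proof.
have /and5P[_ okG _ _ _] := ok.
by rewrite (modular_factor G_bits okG) modular_r mul0r.
Qed.
End ModularEquation.

(** Together with Y^(p+1), and with w = X Y (X + 1) (Y + 1), the four lists expand the following
    equations over Z/2. [R7]: (X + Y)^8 = w (X + Y + 1)^2. [P7]: (X + Y)^8 = X Y (X Y + 1). [R13]:
    (X + Y)^14 = w + (X + Y)^2 w^2. [P13]: (X + Y)^14 = X Y (X + Y + 1)^8. *)
Definition R7 : seq (nat * nat) :=
  [:: (1, 1); (1, 2); (1, 3); (1, 4); (2, 1); (2, 2); (2, 3); (2, 4); (3, 1);
      (3, 2); (4, 1); (4, 2); (8, 0)]%N.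
Definition P7 : seq (nat * nat) := [:: (1, 1); (2, 2); (8, 0)]%N.
Definition R13 : seq (nat * nat) :=
  [:: (1, 1); (1, 2); (2, 1); (2, 2); (2, 4); (2, 6); (2, 12); (4, 2); (4, 6);
      (4, 10); (6, 2); (6, 4); (6, 8); (8, 6); (10, 4); (12, 2); (14, 0)]%N.
Definition P13 : seq (nat * nat) :=
  [:: (1, 1); (1, 9); (2, 12); (4, 10); (6, 8); (8, 6); (9, 1); (10, 4);
      (12, 2); (14, 0)]%N.

Lemma modular_check7 : modular_check 7 ((0, 8) :: R7)%N ((0, 8) :: P7)%N.
Proof. by vm_compute. Qed.
Lemma modular_check13 : modular_check 13 ((0, 14) :: R13)%N ((0, 14) :: P13)%N.
Proof. by vm_compute. Qed.

(** * The base 4 automaton of a recurrence *)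

(* The binary digits of a and b, interleaved: those of a get even positions and
   those of b odd ones. *)
Fixpoint interleave_rec k a b : nat :=
  if k is k.+1 then
    (if (a == 0) && (b == 0) then 0
     else 4 * interleave_rec k a./2 b./2 + odd a + 2 * odd b)%N
  else 0%N.
Definition interleave a b : nat := interleave_rec (a + b) a b.

Lemma interleaveE a b :
  interleave a b = (4 * interleave a./2 b./2 + odd a + 2 * odd b)%N.
Proof.
have rec0 k : interleave_rec k 0 0 = 0%N by case: k.
have stable k : forall l c d, (c + d <= k)%N -> (c + d <= l)%N ->
    interleave_rec k c d = interleave_rec l c d.
  elim: k => [|k IH] [|l] c d //=.
  - rewrite leqn0 addn_eq0 => /andP[/eqP-> /eqP->] _ //.
  - by move=> _; rewrite leqn0 addn_eq0 => /andP[/eqP-> /eqP->].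
  by case: ifP => // nz ck cl; rewrite (IH l) //; lia.
rewrite /interleave; case abE: (a + b)%N => [|k] /=.
  have [-> ->] : a = 0%N /\ b = 0%N by lia.
  by [].
case: ifP => [|nz]; first by lia.
by rewrite (stable k (a./2 + b./2)%N) //; lia.
Qed.

Lemma interleave_digits a b (c d : bool) :
  interleave (c + a.*2) (d + b.*2) = (4 * interleave a b + c + 2 * d)%N.
Proof.
rewrite interleaveE !half_bit_double !oddD !odd_double !addbF.
by case: c d => -[].
Qed.

Lemma interleave_ind (Q : nat -> nat -> Prop) :
  Q 0%N 0%N ->
  (forall a b (c d : bool), Q a b -> Q (c + a.*2)%N (d + b.*2)%N) ->
  forall a b, Q a b.
Proof.
move=> Q0 QS a b; have [k] := ubnP (a + b); elim: k a b => // k IH a b abk.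
have [ab0|ab0] := eqVneq (a + b)%N 0%N.
  by have [-> ->] : a = 0%N /\ b = 0%N by lia.
by rewrite -(odd_double_half a) -(odd_double_half b); apply/QS/IH; lia.
Qed.

Lemma interleave_surj k : exists a b, interleave a b = k.
Proof.
have [m] := ubnP k; elim: m k => // m IH k km; case: (posnP k) => [->|k_gt0].
  by exists 0%N, 0%N.
have [|a [b ab]] := IH (k %/ 4)%N; first by lia.
exists (odd k + a.*2)%N, (odd (k %/ 2) + b.*2)%N.
by rewrite interleave_digits ab; lia.
Qed.

Lemma interleave_inj a b c d : interleave a b = interleave c d -> a = c /\ b = d.
Proof.
have zero : forall c d, interleave c d = 0%N -> c = 0%N /\ d = 0%N.
  apply: interleave_ind => // i j e f IH; rewrite interleave_digits => h.
  have [|-> ->] := IH; first by lia.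
  by case: e f h => -[] //; lia.
move: a b c d; apply: interleave_ind => [c d|a b e f IH c d].
  by move=> /esym/zero[-> ->].
rewrite interleave_digits [RHS]interleaveE => eq.
have [|-> ->] := IH c./2 d./2; first by lia.
move: (odd_double_half c) (odd_double_half d); lia.
Qed.

Section Recurrence.
Variables (n : nat) (P : seq (nat * nat)).

Definition shift_rec (w : seq N) : seq N :=
  rcons (behead w) (sumN [seq shlN (nth 0%num w m.2) m.1 | m <- P]).
Definition rec_seq (s : seq N) k : N := head 0%num (iter k shift_rec s).

Hypotheses (n_gt0 : (0 < n)%N) (P_lt : all (fun m => m.2 < n)%N P).

Lemma size_shift_rec s k : size s = n -> size (iter k shift_rec s) = n.
Proof.
by move=> sn; elim: k => //= k IH; rewrite size_rcons size_behead IH prednK.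
Qed.

Lemma nth_shift_rec s k j : size s = n -> (j < n)%N ->
  nth 0%num (iter k shift_rec s) j = rec_seq s (k + j).
Proof.
move=> sn; elim: j k => [|j IH] k jn; first by rewrite addn0 /rec_seq nth0.
rewrite -addSnnS -IH 1?ltnW //= nth_rcons size_behead size_shift_rec //.
by rewrite -ltnS prednK // jn nth_behead.
Qed.

Lemma rec_seq_init s j : size s = n -> (j < n)%N -> rec_seq s j = nth 0%num s j.
Proof. by move=> sn jn; rewrite -[j in LHS]add0n -nth_shift_rec. Qed.

Lemma rec_seqE s k : size s = n ->
  rec_seq s (k + n) = sumN [seq shlN (rec_seq s (k + m.2)) m.1 | m <- P].
Proof.
move=> sn; rewrite -{1}(prednK n_gt0) addnS -addSn -nth_shift_rec //;
  last by rewrite prednK.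
rewrite /= nth_rcons size_behead size_shift_rec // ltnn eqxx.
congr sumN; apply/eq_in_map => m mP; rewrite nth_shift_rec //.
exact: (allP P_lt).
Qed.

Section Semantics.
Variables (A : comNzRingType) (chA : forall a : A, a + a = 0).

Lemma evN_rec_seq (x : A) s k : size s = n ->
  evN x (rec_seq s (k + n)) = \sum_(m <- P) x ^+ m.1 * evN x (rec_seq s (k + m.2)).
Proof.
move=> sn; rewrite rec_seqE // (evN_sum chA) big_map.
by apply: eq_bigr => m _; rewrite evN_shl.
Qed.

(** The polynomial [l], with x for X and the shift of sequences for Y, annihilates [B]. *)
Definition satisfies (l : seq (nat * nat)) (x : A) (B : nat -> A) : Prop :=
  forall k, \sum_(m <- l) x ^+ m.1 * B (k + m.2)%N = 0.

Lemma evN_rec_satisfies (x : A) s : size s = n ->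
  satisfies ((0%N, n) :: P) x (fun k => evN x (rec_seq s k)).
Proof. by move=> sn k; rewrite big_cons mul1r evN_rec_seq // chA. Qed.

(* Square the relation as an operator: the cross terms cancel in pairs. *)
Lemma satisfies_sq l x B :
  satisfies l x B -> forall c, satisfies l (x ^+ 2) (fun k => B (2 * k + c)%N).
Proof.
move=> sB c k.
under eq_bigr => m _ do rewrite mulnDr addnAC.
move: (2 * k + c)%N => {k c} k.
have diag (f : nat * nat -> nat * nat -> A) : (forall a b, f a b = f b a) ->
    \sum_(a <- l) \sum_(b <- l) f a b = \sum_(a <- l) f a a.
  move=> fC; elim: l {sB} => [|a l IH]; first by rewrite !big_nil.
  rewrite !big_cons -IH.
  under [X in _ + X]eq_bigr => b _ do rewrite big_cons.
  rewrite big_split addrA -[X in X + _]addrA; congr (_ + _).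
  under [X in _ + (_ + X)]eq_bigr => b _ do rewrite fC.
  by rewrite chA addr0.
transitivity (\sum_(a <- l) \sum_(b <- l)
    x ^+ (a.1 + b.1) * B (k + (a.2 + b.2))%N).
  rewrite diag => [|a b]; last by rewrite addnC [(b.2 + _)%N]addnC.
  by apply: eq_bigr => m _; rewrite -exprM !mul2n !addnn.
rewrite big1 // => a _.
transitivity (x ^+ a.1 * \sum_(b <- l) x ^+ b.1 * B (k + a.2 + b.2)%N).
  by rewrite mulr_sumr; apply: eq_bigr => b _; rewrite exprD -mulrA addnA.
by rewrite sB mulr0.
Qed.

Lemma satisfies_four l x B :
  satisfies l x B -> forall c, satisfies l (x ^+ 4) (fun k => B (4 * k + c)%N).
Proof.
move=> sB c k; rewrite (exprM x 2 2).
(* The index splits as 4 k + c = 2 (2 k + c / 2) + c mod 2. *)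
rewrite -[RHS](satisfies_sq (satisfies_sq sB (c %% 2)) (c %/ 2) k).
by apply: eq_bigr => m _; congr (_ * B _); lia.
Qed.

Lemma satisfies_uniq x B C :
  satisfies ((0%N, n) :: P) x B -> satisfies ((0%N, n) :: P) x C ->
  (forall j, (j < n)%N -> B j = C j) -> forall k, B k = C k.
Proof.
move=> sB sC BC k; have [m] := ubnP k; elim: m k => // m IH k km.
have [/BC //|nk] := ltnP k n.
have := sC (k - n)%N; have := sB (k - n)%N; rewrite !big_cons !mul1r subnK //.
rewrite (_ : \sum_(m <- P) x ^+ m.1 * B (k - n + m.2)%N =
    \sum_(m <- P) x ^+ m.1 * C (k - n + m.2)%N).
  by move=> eB eC; apply: addIr (etrans eB (esym eC)).
rewrite big_seq [RHS]big_seq; apply: eq_bigr => j /(allP P_lt) /= jn.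
by congr (_ * _); apply: IH; lia.
Qed.
End Semantics.

Let evX : N -> {poly 'F_2} := evN 'X.

Lemma rec_seq_satisfies s : size s = n ->
  satisfies ((0%N, n) :: P) 'X (fun k => evX (rec_seq s k)).
Proof.
by move=> sn; apply: (evN_rec_satisfies polyF2_add 'X).
Qed.

(** The coefficients of [P] lie in Z/2, so the fourth power of the relation for [t e] is that
    relation with X^4 for X. Both sides thus satisfy the recurrence at X^4, and agreement of the
    first n terms suffices. This is the transition rule of the automaton. *)
Lemma rec_seq_digits s (t : nat -> seq N) c :
  size s = n -> (forall e, (e < 4)%N -> size (t e) = n) ->
  (forall j, (j < n)%N -> rec_seq s (4 * j + c) =
     sumN [seq shlN (sqN (sqN (nth 0%num (t e) j))) e | e <- iota 0 4]) ->
  forall k, evX (rec_seq s (4 * k + c)) =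
    \sum_(e < 4) 'X^e * evX (rec_seq (t e) k) ^+ 4.
Proof.
move=> sn tn init; apply: (@satisfies_uniq _ ('X^4)).
- exact: (satisfies_four polyF2_add (rec_seq_satisfies sn)).
- move=> k; under eq_bigr => m _ do rewrite mulr_sumr.
  rewrite exchange_big big1 //= => e _.
  transitivity ('X^e * (\sum_(m <- (0%N, n) :: P)
      'X^(m.1) * evX (rec_seq (t e) (k + m.2))) ^+ 4); last first.
    by rewrite (rec_seq_satisfies (tn e (ltn_ord e))) expr0n mulr0.
  rewrite poly_F2_four rmorph_sum mulr_sumr; apply: eq_bigr => m _.
  rewrite [X in _ = _ * X](_ : _ =
      ('X^(m.1) * evX (rec_seq (t e) (k + m.2))) ^+ 4); last first.
    exact/esym/poly_F2_four.
  by rewrite [in RHS]exprMn -!exprM mulnC mulrCA.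
move=> j jn; rewrite init // /evX (evN_sum polyF2_add) big_map.
rewrite -(big_mkord xpredT (fun e => 'X^e * evN 'X (rec_seq (t e) j) ^+ 4)).
rewrite /index_iota subn0 big_seq [RHS]big_seq; apply: eq_bigr => e.
rewrite mem_iota /= => e4; rewrite evN_shl !(evN_sq polyF2_add) -exprM.
by rewrite rec_seq_init // tn.
Qed.
End Recurrence.

Lemma coef_digit (c d : bool) i j e (f : {poly 'F_2}) : (e < 4)%N ->
  ('X^e * f ^+ 4)`_(interleave (c + i.*2) (d + j.*2)) =
  if (e == c + 2 * d)%N then f`_(interleave i j) else 0.
Proof.
move=> e4; rewrite interleave_digits poly_F2_four coefXnM coef_comp_poly_Xn //.
have [->|ne] := eqVneq e (c + 2 * d)%N.
  rewrite ltnNge -addnA leq_addl /= addnK dvdn_mulr // mulKn //.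
case: ltnP => // le; case: ifP => // /dvdnP[k kE]; case/eqP: ne.
by case: c d kE le => -[]; lia.
Qed.

Lemma polyF2_addX4 (f g : {poly 'F_2}) : (f + g) ^+ 4 = f ^+ 4 + g ^+ 4.
Proof.
by rewrite (poly_F2_four (f + g)) comp_polyD (poly_F2_four f) (poly_F2_four g).
Qed.

Definition weight i j : nat := (2 * i + 3 * j)%N.
Definition digit_weight c : nat := (2 * odd c + 3 * odd c./2)%N.

(* Every monomial of f has weight at most s - D (none if s < D). *)
Definition low D s (f : {poly 'F_2}) :=
  forall i j, f`_(interleave i j) != 0 -> (weight i j + D <= s)%N.

Lemma low0 D s : low D s 0.
Proof. by move=> i j; rewrite coef0 => /eqP. Qed.

Lemma lowD D s f g : low D s f -> low D s g -> low D s (f + g).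
Proof.
move=> lf lg i j; rewrite coefD; have [->|/lf//] := eqVneq f`_(interleave i j) 0.
by rewrite add0r => /lg.
Qed.

Lemma low_sum D s I (t : seq I) (P : pred I) (f : I -> {poly 'F_2}) :
  (forall i, P i -> low D s (f i)) -> low D s (\sum_(i <- t | P i) f i).
Proof.
by move=> lf; elim/big_ind: _ => //; [exact: low0 | exact: lowD].
Qed.

(** As f^4 = f(X^4), passing to X^e f^4 appends the base 4 digit e to every exponent, which doubles
    its weight and adds [digit_weight e]. The index gains the digit c + 2 d in the same way. *)
Lemma low_digit D D' (c d : bool) a b e (f : {poly 'F_2}) : (e < 4)%N ->
  (D + digit_weight e <= 2 * D' + digit_weight (c + 2 * d))%N ->
  low D' (weight a b) f ->
  low D (weight (c + a.*2) (d + b.*2)) ('X^e * f ^+ 4).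
Proof.
move=> e4 De lf i j; rewrite -(odd_double_half i) -(odd_double_half j) coef_digit //.
case: ifP => [/eqP eE|_ /eqP//].
move=> /lf; move: De; rewrite {}eE /weight /digit_weight.
by case: (odd i) (odd j) c d => -[] [] []; rewrite /=; lia.
Qed.

(* The leading term of a state: 0 for type 0, the monomial itself for type 1,
   and for type 2 the monomial with b (if y holds) or a (otherwise) decreased. *)
Definition lead_term (y : bool) (ty a b : nat) : {poly 'F_2} :=
  match ty with
  | 0%N => 0
  | 1%N => 'X^(interleave a b)
  | _ => if y then (if b is b'.+1 then 'X^(interleave a b') else 0)
         else (if a is a'.+1 then 'X^(interleave a' b) else 0)
  end.

Definition step (y : bool) : nat := if y then 3%N else 2%N.

(** Subtraction of 1 in binary, lowest digit first. Type 2 has still to subtract: a digit 1 is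
    cleared and the rest is copied (type 1), a digit 0 becomes 1 and the borrow goes on (type 2).
    Only the bit of a or of b marked by [bit] is concerned. *)
Definition lead_digit (y : bool) (ty c : nat) : option (nat * nat) :=
  let bit := if y then 2%N else 1%N in
  match ty with
  | 0 => None
  | 1 => Some (c, 1)
  | _ => if (if y then odd c./2 else odd c) then Some (c - bit, 1) else Some (c + bit, 2)
  end%N.

Lemma lead_digit_lt y ty c e ty' : (c < 4)%N ->
  lead_digit y ty c = Some (e, ty') -> (e < 4)%N.
Proof.
by case: ty c => [|[|ty]] [|[|[|[|c]]]] //= _; case: y => -[<-].
Qed.

Lemma Xn_four e k : 'X^e * ('X^k) ^+ 4 = 'X^(4 * k + e) :> {poly 'F_2}.
Proof. by rewrite -exprM -exprD addnC mulnC. Qed.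

Lemma lead_term_digit y ty (c d : bool) a b :
  lead_term y ty (c + a.*2) (d + b.*2) =
  if lead_digit y ty (c + 2 * d) is Some (e, ty') then
    'X^e * lead_term y ty' a b ^+ 4 else 0.
Proof.
case: ty => [|[|ty]] //; rewrite /lead_term /lead_digit.
  by rewrite Xn_four interleave_digits addnA.
case: y; case: c d => -[] /=; rewrite ?add0n ?add1n.
- by rewrite Xn_four -[a.*2.+1]/(true + a.*2)%N -[X in interleave _ X]/(false + b.*2)%N
    interleave_digits addn0.
- case: b => [|b]; rewrite ?expr0n ?mulr0 // Xn_four doubleS.
  rewrite -[a.*2.+1]/(true + a.*2)%N -[X in interleave _ X]/(true + b.*2)%N.
  by rewrite interleave_digits; congr 'X^_; lia.
- by rewrite Xn_four -[a.*2]/(false + a.*2)%N -[X in interleave _ X]/(false + b.*2)%N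
    interleave_digits !addn0.
- case: b => [|b]; rewrite ?expr0n ?mulr0 // Xn_four doubleS.
  rewrite -[a.*2]/(false + a.*2)%N -[X in interleave _ X]/(true + b.*2)%N.
  by rewrite interleave_digits; congr 'X^_; lia.
- by rewrite Xn_four -[b.*2.+1]/(true + b.*2)%N -[X in interleave X _]/(false + a.*2)%N
    interleave_digits; congr 'X^_; lia.
- by rewrite Xn_four -[b.*2]/(false + b.*2)%N -[X in interleave X _]/(false + a.*2)%N
    interleave_digits; congr 'X^_; lia.
- case: a => [|a]; rewrite ?expr0n ?mulr0 // Xn_four doubleS.
  rewrite -[b.*2.+1]/(true + b.*2)%N -[X in interleave X _]/(true + a.*2)%N.
  by rewrite interleave_digits; congr 'X^_; lia.
- case: a => [|a]; rewrite ?expr0n ?mulr0 // Xn_four doubleS.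
  rewrite -[b.*2]/(false + b.*2)%N -[X in interleave X _]/(true + a.*2)%N.
  by rewrite interleave_digits; congr 'X^_; lia.
Qed.

Lemma low_lead y ty a b : low (if ty is _.+2 then step y else 0) (weight a b)
  (lead_term y ty a b).
Proof.
have lowX D s i j : (weight i j + D <= s)%N -> low D s 'X^(interleave i j).
  move=> le k l; rewrite coefXn.
  by have [/interleave_inj[-> ->] //|_ /eqP] := interleave k l =P interleave i j.
case: ty => [|[|ty]] /=; first exact: low0.
  by apply: lowX; rewrite addn0.
by case: y; [case: b => [|b]|case: a => [|a]]; try exact: low0; apply: lowX;
  rewrite /weight /step; lia.
Qed.

Section Automaton.
Variables (y : bool) (n : nat) (P : seq (nat * nat)).

(* split4 a lists the a_e with a = sum over e < 4 of X^e a_e(X^4). *)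
Fixpoint halves (p : positive) : N * N :=
  match p with
  | xH => (1, 0)%num
  | xO p => let: (u, v) := halves p in (N.double v, u)
  | xI p => let: (u, v) := halves p in (N.succ_double v, u)
  end.
Definition split2 (a : N) : N * N := if a is Npos p then halves p else (0, 0)%num.
Definition split4 (a : N) : seq N :=
  let: (u, v) := split2 a in
  let: (u0, u1) := split2 u in let: (v0, v1) := split2 v in [:: u0; v0; u1; v1].

Definition rec_values (s : seq N) k : seq N :=
  [seq head 0%num w | w <- traject (shift_rec P) s k].

(* The transitions of a state are listed by 4 * c + e, with c the base 4 digit
   of the index and e that of the exponent. *)
Definition successors (s : seq N) : seq (seq N) :=
  let vals := [seq split4 a | a <- rec_values s (4 * n)%N] in
  flatten [seq [seq [seq nth 0%num (nth [::] vals (4 * j + c)%N) e | j <- iota 0 n]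
                  | e <- iota 0 4] | c <- iota 0 4].

Fixpoint explore fuel k (sts : seq (seq N)) (trs : seq (seq nat)) :=
  if fuel is fuel.+1 then
    if (k < size sts)%N then
      let sts' := foldl (fun l s => if s \in l then l else rcons l s) sts
                    (successors (nth [::] sts k)) in
      explore fuel k.+1 sts'
        (rcons trs [seq index s sts' | s <- successors (nth [::] sts k)])
    else (sts, trs)
  else (sts, trs).

(* The lower bounds [deficits] and the types are found by a few rounds of
   relaxation, with 100 for infinity.  Nothing is proved about this search: its
   outcome is verified by [check_automaton]. *)
Definition tr (trs : seq (seq nat)) q c e := nth 0%N (nth [::] trs q) (4 * c + e)%N.

Definition relax (trs : seq (seq nat)) (ds : seq nat) : seq nat :=
  [seq foldr minn (nth 0%N ds q)
         [seq (2 * nth 0 ds (tr trs q x.1 x.2) + digit_weight x.1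
               - digit_weight x.2)%N | x <- [seq (c, e) | c <- iota 0 4, e <- iota 0 4]]
     | q <- iota 0 (size ds)].

Definition propagate (trs : seq (seq nat)) (ts : seq nat) : seq nat :=
  foldl (fun ts x => let: (q, c) := x in
           if lead_digit y (nth 0%N ts q) c is Some (e, ty)
           then set_nth 0%N ts (tr trs q c e) ty else ts)
        ts [seq (q, c) | q <- iota 0 (size ts), c <- iota 0 4].

(* A state is the list of the first n terms of a solution of the recurrence. *)
Record automaton := Automaton {
  states : seq (seq N); transitions : seq (seq nat);
  types : seq nat; deficits : seq nat }.

Definition build fuel (s : seq N) : automaton :=
  let: (sts, trs) := explore fuel 0 [:: s] [::] in
  let ts := iter 10 (propagate trs) (2%N :: nseq (size sts).-1 0%N) in
  let ds := iter 5 (relax trs)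
    [seq if head 0%num s == 0%num then 100%N else 0%N | s <- sts] in
  Automaton sts trs ts [seq ((0 < x.1) + x.2)%N | x <- zip ts ds].

Section Check.
Variable M : automaton.
Let state q := nth [::] (states M) q.
Let ty q := nth 0%N (types M) q.
Let def q := nth 0%N (deficits M) q.
Let trans := tr (transitions M).

Definition check_base q : bool :=
  let a := nth 0%num (state q) 0 in
  match ty q with
  | 0 => (a == 0%num) || (a == 1%num) && (def q == 0)
  | 1 => a == 1%num
  | _ => a == 0%num
  end%N.

Definition check_digits q c : bool :=
  let vals := rec_values (state q) (4 * n)%N in
  all (fun j => nth 0%num vals (4 * j + c)%N ==
    sumN [seq shlN (sqN (sqN (nth 0%num (state (trans q c e)) j))) e | e <- iota 0 4])
    (iota 0 n).

(** The exponent digit prescribed by [lead_digit] must lead to the prescribed type. The leading term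
    of any other successor is surplus and has to fit the bound on the remainder; in type 2 it lies
    [step y] below its index, hence [2 * step y]. *)
Definition check_weight q c e : bool :=
  let q' := trans q c e in
  [&& q' < size (states M),
      def q + digit_weight e <= 2 * def q' + digit_weight c &
      if lead_digit y (ty q) c == Some (e, ty q') then true else
      (if lead_digit y (ty q) c is Some (e', _) then e != e' else true) &&
      match ty q' with
      | 0 => true
      | 1 => def q + digit_weight e <= digit_weight c
      | _ => def q + digit_weight e <= 2 * step y + digit_weight c
      end]%N.

Definition check_automaton : bool :=
  all (fun q => [&& size (state q) == n, check_base q &
      all (fun c => check_digits q c && all (check_weight q c) (iota 0 4)) (iota 0 4)])
    (iota 0 (size (states M))).

Hypotheses (n_gt0 : (0 < n)%N) (P_lt : all (fun m => m.2 < n)%N P).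
Hypothesis ok : check_automaton.

Lemma nth_rec_values s k j : (j < k)%N -> nth 0%num (rec_values s k) j = rec_seq P s j.
Proof.
by move=> jk; rewrite (nth_map s) ?size_traject // nth_traject.
Qed.

(** Induction on the digits of a and b. The term of index 4 k + c is the sum of X^e u_e^4 over the
    successors u_e. Their remainders stay low by [low_digit], at most one of their leading terms is
    the one expected by [lead_term_digit], and [check_weight] bounds the others. *)
Lemma automaton_lead a b q : (q < size (states M))%N ->
  low (def q) (weight a b)
    (evN 'X (rec_seq P (state q) (interleave a b)) - lead_term y (ty q) a b).
Proof.
have okq j : (j < size (states M))%N -> [&& size (state j) == n, check_base j &
    all (fun c => check_digits j c && all (check_weight j c) (iota 0 4)) (iota 0 4)].
  by move=> jN; apply: (allP ok); rewrite mem_iota.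
move: a b q; apply: interleave_ind => [q qN|a b c d IH q qN].
  have /and3P[/eqP sq bq _] := okq q qN.
  rewrite (@rec_seq_init n P n_gt0 _ 0 sq n_gt0); move: bq; rewrite /check_base.
  case: (ty q) => [|[|t]] /=.
  - rewrite subr0; case/orP => [/eqP->|/andP[/eqP-> /eqP->]]; first exact: low0.
    move=> i j; rewrite coef1; have [/(@interleave_inj i j 0 0)[-> ->] //|_ /eqP//] :=
      interleave i j =P 0%N.
  - by move=> /eqP->; rewrite expr0 subrr; apply: low0.
  - by move=> /eqP->; case: y; rewrite subr0; apply: low0.
have /and3P[/eqP sq _ /allP/(_ (c + 2 * d)%N)] := okq q qN.
have c4 : (c + 2 * d < 4)%N by case: c d => -[].
rewrite mem_iota => /(_ c4)/andP[/allP dig /allP wts].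
have qs e : (e < 4)%N -> check_weight q (c + 2 * d) e.
  by move=> e4; apply: wts; rewrite mem_iota.
have trN e : (e < 4)%N -> (trans q (c + 2 * d) e < size (states M))%N.
  by move=> /qs/and3P[].
rewrite interleave_digits -addnA.
rewrite (@rec_seq_digits n P n_gt0 P_lt _ (fun e => state (trans q (c + 2 * d) e))) //.
- pose t e := trans q (c + 2 * d) e.
  pose R e : {poly 'F_2} :=
    evN 'X (rec_seq P (state (t e)) (interleave a b)) - lead_term y (ty (t e)) a b.
  pose L e : {poly 'F_2} := 'X^e * lead_term y (ty (t e)) a b ^+ 4.
  have -> : \sum_(e < 4) 'X^e * evN 'X (rec_seq P (state (t e)) (interleave a b)) ^+ 4
      = \sum_(e < 4) 'X^e * R e ^+ 4 + \sum_(e < 4) L e.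
    rewrite -big_split /=; apply: eq_bigr => e _.
    by rewrite /L -mulrDr -polyF2_addX4 subrK.
  rewrite -addrA; apply: lowD.
    apply: low_sum => e _; have /and3P[_ w _] := qs e (ltn_ord e).
    by apply: low_digit w _ => //; apply: IH; apply: trN.
  have lowL e : (e < 4)%N ->
     (lead_digit y (ty q) (c + 2 * d) != Some (e, ty (t e))) ->
     low (def q) (weight (c + a.*2) (d + b.*2)) (L e).
    move=> e4 /negPf ne; have /and3P[_ _] := qs e e4; rewrite ne => /andP[_ w].
    have := @low_lead y (ty (t e)) a b; rewrite /L; move: w; rewrite -/(t e).
    case: (ty (t e)) => [|[|ty']] w lw.
    - by rewrite /= expr0n mulr0; apply: low0.
    - by apply: low_digit lw => //; rewrite muln0.
    - exact: low_digit lw.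
  rewrite lead_term_digit; case lE: lead_digit => [[e0 ty0]|]; last first.
    by rewrite subr0; apply: low_sum => e _; apply: lowL; rewrite ?lE.
  have e04 : (e0 < 4)%N.
    exact: lead_digit_lt lE.
  have ty0E : ty0 = ty (t e0).
    have /and3P[_ _] := qs e0 e04; rewrite lE eqxx /=.
    by case: eqP => // -[].
  rewrite (bigD1 (Ordinal e04)) //= /L -ty0E addrAC subrr add0r.
  apply: low_sum => e /negPf ne; apply: lowL => //; rewrite lE.
  by apply/eqP => -[ee _]; rewrite -val_eqE /= ee eqxx in ne.
- by move=> e e4; have /and3P[/eqP] := okq _ (trN e e4).
move=> j jn; have jI : j \in iota 0 n by rewrite mem_iota.
rewrite -(eqP (dig j jI)).
by rewrite nth_rec_values //; lia.
Qed.
End Check.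
End Automaton.

(** * Adapted bases from leading terms *)

Section Triangular.
Variables (K : fieldType) (V : lmodType K) (X Y : {linear V -> V}).
Variables (e : nat -> nat -> V) (lam : {scalar V}).

(** The bound is strict, so [filt 0] is zero; with truncated subtraction, [leadX] and [leadY] below
    become exact equalities at small weights. *)
Definition filt s (v : V) := exists2 t : seq (K * (nat * nat)),
  v = \sum_(x <- t) x.1 *: e x.2.1 x.2.2 &
  all (fun x => weight x.2.1 x.2.2 < s)%N t.

Hypothesis comm : forall v, X (Y v) = Y (X v).
Hypothesis spanning : forall v, exists s, filt s v.
Hypothesis lam_e : forall a b, lam (e a b) = ((a == 0%N) && (b == 0%N))%:R.
Hypothesis leadX : forall a b,
  filt (weight a b - 2) (X (e a b) - if a is a'.+1 then e a' b else 0).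
Hypothesis leadY : forall a b,
  filt (weight a b - 3) (Y (e a b) - if b is b'.+1 then e a b' else 0).

Lemma filt_e s a b : (weight a b < s)%N -> filt s (e a b).
Proof.
by move=> ab; exists [:: (1, (a, b))]; rewrite ?big_seq1 ?scale1r //= ab.
Qed.

Lemma filt_zero s : filt s 0.
Proof. by exists [::]; rewrite ?big_nil. Qed.

Lemma filtD s u v : filt s u -> filt s v -> filt s (u + v).
Proof.
move=> [t -> ts] [t' -> ts']; exists (t ++ t'); rewrite ?big_cat //.
by rewrite all_cat ts.
Qed.

Lemma filtZ s k v : filt s v -> filt s (k *: v).
Proof.
move=> [t -> ts]; exists [seq (k * x.1, x.2) | x <- t].
  by rewrite big_map scaler_sumr; apply: eq_bigr => x _; rewrite scalerA.
by rewrite all_map.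
Qed.

Lemma filtS s s' v : (s <= s')%N -> filt s v -> filt s' v.
Proof.
move=> ss' [t -> /allP ts]; exists t => //.
by apply/allP => x /ts /= xs; apply: leq_trans ss'.
Qed.

Lemma filt0 v : filt 0 v -> v = 0.
Proof. by case=> -[|x t] -> //= _; rewrite big_nil. Qed.

Lemma filt_sub s u v : filt s (u - v) -> filt s v -> filt s u.
Proof. by move=> uv sv; rewrite -[u](subrK v); apply: filtD. Qed.

Lemma filt_trans s u v w : filt s (u - v) -> filt s (v - w) -> filt s (u - w).
Proof. by move=> uv vw; rewrite -(subrKA v); apply: filtD. Qed.

Lemma filt_linear (T : {linear V -> V}) k s v :
  (forall a b, (weight a b < s)%N -> filt (s - k) (T (e a b))) ->
  filt s v -> filt (s - k) (T v).
Proof.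
move=> Te [t -> /allP ts]; rewrite linear_sum big_seq.
elim/big_ind: _ => [|u w|x /ts /= xs]; [exact: filt_zero|exact: filtD|].
by rewrite linearZ; apply/filtZ/Te.
Qed.

Lemma filtX s v : filt s v -> filt (s - 2) (X v).
Proof.
apply: filt_linear => a b ab; apply: filt_sub (filtS _ (leadX a b)) _.
  by apply: leq_sub2r; apply: ltnW.
case: a ab => [|a] ab; first exact: filt_zero.
by apply: filt_e; move: ab; rewrite /weight; lia.
Qed.

Lemma filtY s v : filt s v -> filt (s - 3) (Y v).
Proof.
apply: filt_linear => a b ab; apply: filt_sub (filtS _ (leadY a b)) _.
  by apply: leq_sub2r; apply: ltnW.
case: b ab => [|b] ab; first exact: filt_zero.
by apply: filt_e; move: ab; rewrite /weight; lia.
Qed.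

Lemma filt_iterX i s v : filt s v -> filt (s - 2 * i) (iter i X v).
Proof.
by elim: i => [|i IH] sv; rewrite ?subn0 //= mulnSr subnDA; apply/filtX/IH.
Qed.

Lemma filt_iterY i s v : filt s v -> filt (s - 3 * i) (iter i Y v).
Proof.
by elim: i => [|i IH] sv; rewrite ?subn0 //= mulnSr subnDA; apply/filtY/IH.
Qed.

Lemma iter_lin (T : {linear V -> V}) i : linear (iter i T).
Proof. by elim: i => // i IH k u v; rewrite /= IH linearP. Qed.

Lemma iterB (T : {linear V -> V}) i u v : iter i T (u - v) = iter i T u - iter i T v.
Proof. by elim: i => //= i ->; rewrite linearB. Qed.

Lemma leadX_iter i a b : filt (weight a b - 2 * i)
  (iter i X (e a b) - if (i <= a)%N then e (a - i)%N b else 0).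
Proof.
elim: i => [|i IH]; first by rewrite !subn0 subrr; apply: filt_zero.
rewrite /= mulnSr subnDA; have := filtX IH; rewrite linearB /= => h.
apply: filt_trans h _; have [ia|ia] := leqP i a; last first.
  by rewrite raddf0 leqNgt (leqW ia) subr0; apply: filt_zero.
have := leadX (a - i) b; have [ia'|ia'] := ltnP i a.
  rewrite -(subnSK ia') => h'; apply: filtS h'.
  by rewrite /weight; lia.
have -> : (a - i = 0)%N by lia.
by move=> h'; apply: filtS h'; rewrite /weight; lia.
Qed.

Lemma leadY_iter i a b : filt (weight a b - 3 * i)
  (iter i Y (e a b) - if (i <= b)%N then e a (b - i)%N else 0).
Proof.
elim: i => [|i IH]; first by rewrite !subn0 subrr; apply: filt_zero.
rewrite /= mulnSr subnDA; have := filtY IH; rewrite linearB /= => h.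
apply: filt_trans h _; have [ib|ib] := leqP i b; last first.
  by rewrite raddf0 leqNgt (leqW ib) subr0; apply: filt_zero.
have := leadY a (b - i); have [ib'|ib'] := ltnP i b.
  rewrite -(subnSK ib') => h'; apply: filtS h'.
  by rewrite /weight; lia.
have -> : (b - i = 0)%N by lia.
by move=> h'; apply: filtS h'; rewrite /weight; lia.
Qed.

(* The coordinates of v in the adapted basis. *)
Definition coordXY (i j : nat) (v : V) : K := lam (iter i X (iter j Y v)).

Lemma coordXY_linear i j : scalar (coordXY i j).
Proof. by move=> k u v; rewrite /coordXY iter_lin iter_lin linearP. Qed.
HB.instance Definition _ i j :=
  GRing.isLinear.Build K V K *%R (coordXY i j) (coordXY_linear i j).

(** X^i Y^j lowers the filtration by [weight i j], so all error terms fall into [filt 0] and only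
    the exact shift of indices remains. *)
Lemma coordXY_e i j a b : (weight a b <= weight i j)%N ->
  coordXY i j (e a b) = ((i == a) && (j == b))%:R.
Proof.
move=> le; have lY := leadY_iter j a b.
have iX0 : iter i X 0 = 0 by elim: (i) => //= k ->; rewrite linear0.
have lXY : filt 0 (iter i X (iter j Y (e a b)) -
    iter i X (if (j <= b)%N then e a (b - j)%N else 0)).
  rewrite -iterB; have := filt_iterX i lY; apply: filtS.
  by move: le; rewrite /weight; lia.
have {lXY} : filt 0 (iter i X (iter j Y (e a b)) -
    if (i <= a)%N && (j <= b)%N then e (a - i)%N (b - j)%N else 0).
  apply: filt_trans lXY _; case: (leqP j b) => jb; last first.
    by rewrite iX0 andbF subr0; apply: filt_zero.
  rewrite andbT; have := leadX_iter i a (b - j); apply: filtS.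
  by move: le; rewrite /weight; lia.
move=> /filt0/eqP; rewrite subr_eq0 /coordXY => /eqP->.
case: ifP => [/andP[ia jb]|nab]; first by rewrite lam_e; congr (_%:R); lia.
rewrite linear0 (_ : _ && _ = false) //.
by apply: contraFF nab => /andP[/eqP-> /eqP->]; rewrite !leqnn.
Qed.

Definition box N : seq (nat * nat) := [seq (i, j) | i <- iota 0 N, j <- iota 0 N].

Lemma mem_box N x : (x \in box N) = (x.1 < N)%N && (x.2 < N)%N.
Proof.
apply/allpairsP/idP => [[[i j] /= [iN jN ->]]|/andP[iN jN]].
  by move: iN jN; rewrite !mem_iota /= => -> ->.
by exists x; rewrite !mem_iota; split=> //; case: x {iN jN}.
Qed.

Lemma box_uniq N : uniq (box N).
Proof. by apply: allpairs_uniq; rewrite ?iota_uniq // => -[i j] [k l]. Qed.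

Let wt (x : nat * nat) := weight x.1 x.2.
Let co (x : nat * nat) v := coordXY x.1 x.2 v.
Let ex (x : nat * nat) := e x.1 x.2.

(** Inverts the matrix of the [co x (ex y)], which [coordXY_e] shows to be unitriangular for the
    weight. Here s is fuel, and [box s] contains every pair of weight below s. *)
Fixpoint dual_rec s (x : nat * nat) : V :=
  if s is s.+1 then
    if wt x == s
    then ex x - \sum_(y <- box s | (wt y < s)%N) co y (ex x) *: dual_rec s y
    else dual_rec s x
  else 0.
Definition dual x : V := dual_rec (wt x).+1 x.

Lemma dual_recE s x : (wt x < s)%N -> dual_rec s x = dual x.
Proof.
elim: s => // s IH; rewrite ltnS leq_eqVlt => /orP[/eqP xs|xs].
  by rewrite /dual xs.
by rewrite /= ltn_eqF // IH.
Qed.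

Lemma dualE x : ex x = dual x +
  \sum_(y <- box (wt x) | (wt y < wt x)%N) co y (ex x) *: dual y.
Proof.
rewrite /dual /= eqxx -[LHS](subrK
  (\sum_(y <- box (wt x) | (wt y < wt x)%N) co y (ex x) *: dual y)).
by congr (_ - _ + _); apply: eq_bigr => y yx; rewrite dual_recE.
Qed.

Lemma co_dual x y : co x (dual y) = (x == y)%:R.
Proof.
have [s] := ubnP (wt y); elim: s y => // s IH y ys.
have := congr1 (co x) (dualE y); rewrite /co linearD linear_sum /=.
rewrite (eq_bigr (fun z => co z (ex y) * (x == z)%:R)) => [|z zy]; last first.
  by rewrite linearZ /= -/(co x _) IH //; apply: leq_trans zy _; rewrite -ltnS.
(* If x has the smaller weight, its term in the sum already equals [co x (ex y)]; otherwise the sum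
   contributes nothing. *)
have [xy|yx] := ltnP (wt x) (wt y).
  rewrite big_mkcond (bigD1_seq x) ?box_uniq //=; last first.
    rewrite mem_box; apply/andP; split; apply: leq_ltn_trans xy;
      by rewrite /wt /weight; move: x.1 x.2 => i j; lia.
  rewrite xy eqxx mulr1 big1 ?addr0 => [|z /negPf zx]; last first.
    by rewrite eq_sym zx mulr0; case: ifP.
  move/eqP; rewrite -subr_eq subrr => /eqP <-.
  by case: eqP xy => // ->; rewrite ltnn.
rewrite big1 ?addr0 => [<-|z zy]; last first.
  by case: eqP zy => [<-|]; rewrite ?mulr0 // ltnNge yx.
by rewrite coordXY_e // -surjective_pairing; case: x y {ys yx} => ? ? [].
Qed.

(** The expansion holds over every large box, so that [coordXY_inj] can compare two vectors over the
    same one. *)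
Lemma dual_span v : exists N, forall M, (N <= M)%N ->
  v = \sum_(x <- box M) co x v *: dual x.
Proof.
have [s [t -> _]] := spanning v; elim: t => [|[k [a b]] t [N IH]].
  exists 0%N => M _; rewrite big_nil big1 // => x _.
  by rewrite /co linear0 scale0r.
exists (maxn N (weight a b).+1) => M; rewrite geq_max => /andP[NM abM].
rewrite big_cons {1}(IH M NM) /=.
rewrite [RHS](eq_bigr (fun x => k *: (co x (e a b) *: dual x) +
   co x (\sum_(y <- t) y.1 *: e y.2.1 y.2.2) *: dual x)) => [|x _]; last first.
  by rewrite /co linearD linearZ /= scalerDl scalerA.
rewrite big_split /= -scaler_sumr; congr (_ *: _ + _).
rewrite [LHS](dualE (a, b) : e a b = _).
rewrite [RHS](bigD1_seq (a, b)) ?box_uniq //=; last first.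
  by rewrite mem_box /=; move: abM; rewrite /weight; lia.
rewrite [in RHS]/co [in RHS]/= coordXY_e // !eqxx scale1r; congr (_ + _).
transitivity (\sum_(y <- box M | (wt y < wt (a, b))%N) co y (e a b) *: dual y).
  rewrite -big_filter -[RHS]big_filter; apply: perm_big.
  apply: uniq_perm; rewrite ?filter_uniq ?box_uniq // => y.
  rewrite !mem_filter !mem_box; case: ltnP => //= yab.
  by move: yab abM; rewrite /wt /weight /=; lia.
rewrite big_mkcond [RHS]big_mkcond; apply: eq_bigr => y _.
have [yab|aby] := ltnP; first by case: eqP yab => // ->; rewrite ltnn.
case: eqP => // ne; rewrite coordXY_e //.
case: andP => [[/eqP ya /eqP yb]|]; last by rewrite scale0r.
by case: ne; case: y ya yb {aby} => ? ? /= -> ->.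
Qed.

Lemma coordXY_inj u v : (forall i j, coordXY i j u = coordXY i j v) -> u = v.
Proof.
move=> uv; have [N uN] := dual_span u; have [N' vN] := dual_span v.
rewrite (uN (maxn N N')) ?leq_maxl // (vN (maxn N N')) ?leq_maxr //.
by apply: eq_bigr => x _; rewrite /co uv.
Qed.

Lemma iterYX j v : iter j Y (X v) = X (iter j Y v).
Proof. by elim: j => //= j ->; rewrite comm. Qed.

(** X and Y shift the coordinates: [coordXY i j (X v)] is [coordXY i.+1 j v] because X and Y
    commute. On the dual family this is the adapted rule, as coordinates determine a vector. *)
Lemma triangular_adapted : exists m : nat -> nat -> V,
  adapted_basis X Y m /\ m 0%N 0%N = e 0%N 0%N.
Proof.
exists (fun i j => dual (i, j)); split; last first.
  by have := dualE (0%N, 0%N); rewrite big_nil addr0 => <-.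
have coX i j v : coordXY i j (X v) = coordXY i.+1 j v.
  by rewrite /coordXY iterYX -iterSr.
have coY i j v : coordXY i j (Y v) = coordXY i j.+1 v by rewrite /coordXY -iterSr.
have coE i j y : coordXY i j (dual y) = ((i, j) == y)%:R by exact: (co_dual (i, j)).
split=> [|i j|j|i j|i]; try by apply: coordXY_inj => k l;
  rewrite ?coX ?coY ?coE ?linear0 !xpair_eqE ?eqSS ?andbF.
split=> [s c us sum0 x xs|v].
  have := congr1 (co x) sum0; rewrite /co linear0 linear_sum /=.
  rewrite (bigD1_seq x) //= big1 ?addr0 => [|y yx]; rewrite linearZ /= coE.
    by rewrite -surjective_pairing eqxx mulr1.
  by rewrite -!surjective_pairing eq_sym (negPf yx) mulr0.
have [N vN] := dual_span v; exists (box N), (fun x => co x v).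
by rewrite {1}(vN N) //; apply: eq_bigr => -[].
Qed.
End Triangular.

(** * The operators on K1/N1 and K5/N1 *)

Lemma hecke_linear p : linear (hecke p).
Proof.
move=> k f g; apply: fpsP => n; rewrite fps_coefD /=.
by rewrite mulrDr addrACA; case: ifP; rewrite ?mulr0 ?addr0.
Qed.
HB.instance Definition _ p :=
  GRing.isLinear.Build 'F_2 (fps 'F_2) (fps 'F_2) *:%R (hecke p) (hecke_linear p).

Lemma heckeE p f n :
  hecke p f n = f (p * n)%N + (if (p %| n)%N then f (n %/ p)%N else 0).
Proof. by []. Qed.

Lemma heckeC p q f : prime p -> prime q -> p != q ->
  hecke p (hecke q f) = hecke q (hecke p f).
Proof.
move=> p_pr q_pr pq; apply: fpsP => n; rewrite !heckeE.
have p_gt0 := prime_gt0 p_pr; have q_gt0 := prime_gt0 q_pr.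
have cpq : coprime p q by rewrite prime_coprime // dvdn_prime2.
have cqp : coprime q p by rewrite coprime_sym.
rewrite !Gauss_dvdr // [(q * (p * n))%N]mulnCA -!addrA; congr (_ + _).
have [pn|pn] := boolP (p %| n)%N; have [qn|qn] := boolP (q %| n)%N;
  rewrite ?addr0 ?add0r //.
- have pqn : (p * q %| n)%N by rewrite Gauss_dvd // pn.
  have -> : (q %| n %/ p)%N by rewrite dvdn_divRL // mulnC.
  have -> : (p %| n %/ q)%N by rewrite dvdn_divRL.
  by rewrite !muln_divA // -!divnMA [(q * p)%N]mulnC addrCA.
- have -> : (q %| n %/ p)%N = false.
    by apply: contraNF qn => qnp; rewrite -(divnK pn) dvdn_mulr.
  by rewrite muln_divA // addr0.
- have -> : (p %| n %/ q)%N = false.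
    by apply: contraNF pn => pnq; rewrite -(divnK qn) dvdn_mulr.
  by rewrite muln_divA // addr0.
Qed.

Section Prime.
Notation t := (G ^+ 2).
Variables (p : nat) (R P : seq (nat * nat)).
Hypotheses (p_pr : prime p) (p_odd : odd p).
Hypothesis R_sym : perm_eq ((0%N, p.+1) :: R) [seq (m.2, m.1) | m <- (0%N, p.+1) :: R].
Hypothesis P_sym : perm_eq ((0%N, p.+1) :: P) [seq (m.2, m.1) | m <- (0%N, p.+1) :: P].
Hypotheses (R_lt : all (fun m => m.2 < p.+1)%N R) (P_lt : all (fun m => m.2 < p.+1)%N P).
Hypothesis ok : modular_check p ((0%N, p.+1) :: R) ((0%N, p.+1) :: P).

Let p_gt0 : (0 < p)%N := prime_gt0 p_pr.

(** Over Z/2, t = G^2 is G(x^2), so the equation of G becomes that of t under x -> x^2. *)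
Lemma t_rel : evM t (fps_pow p t) ((0%N, p.+1) :: P) = 0.
Proof.
have := congr1 (fps_pow 2) (modular_G p_gt0 ok); rewrite fps_pow_evM.
rewrite (fps_powC G (isT : 0 < 2)%N p_gt0) -fps_sq => ->.
exact: rmorph0.
Qed.

Definition trace_bits (tbl : seq N) (a : N) : N :=
  sumN [seq nth 0%num tbl i | i <- bitsN a].

Lemma hecke_evN K a : all (fun i => i < K)%N (bitsN a) ->
  hecke p (evN r a) = evN r (trace_bits (newton_tbl R p.+1 K) a).
Proof.
move=> /allP aK; rewrite evN_bits linear_sum (evN_sum fps2) big_map.
rewrite big_seq [RHS]big_seq; apply: eq_bigr => i /aK /= iK.
exact: (hecke_exp p_pr p_odd R_sym (modular_r p_gt0 ok) R_lt r_lead iK).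
Qed.

Section Generator.
Variables (g : fps 'F_2) (gb : N) (K : nat) (a b : seq N).
Hypothesis g_bits : g = evN r gb.

Let G2 : N := expN Gbits 2.

(* T_p(g t^k) = g a_k(t) + G b_k(t) for k <= p. *)
Definition initial_check : bool :=
  let tbl := newton_tbl R p.+1 K in
  [&& size a == p.+1, size b == p.+1 &
   all (fun k => let f := mulN gb (expN G2 k) in
     all (fun i => i < K)%N (bitsN f) &&
     (trace_bits tbl f == N.lxor (mulN gb (compN (nth 0%num a k) G2))
                            (mulN Gbits (compN (nth 0%num b k) G2))))
   (iota 0 p.+1)].

Hypothesis ini : initial_check.

(** Up to k = p these are computed values; beyond, T_p(g t^k) and both coefficient sequences obey
    the recurrence of [P]. *)
Lemma hecke_generator k :
  hecke p (g * t ^+ k) = g * evN t (rec_seq P a k) + G * evN t (rec_seq P b k).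
Proof.
have /and3P[/eqP sa /eqP sb /allP init] := ini.
have tE : t = evN r G2 by rewrite G_bits -(evN_exp fps2).
have [m] := ubnP k; elim: m k => // m IH k km.
have [kp|pk] := ltnP k p.+1; last first.
  rewrite -(subnK pk) (hecke_rec p_pr p_odd P_sym t_rel).
  rewrite !(evN_rec_seq _ P_lt fps2) // !mulr_sumr -big_split /=.
  rewrite big_seq [RHS]big_seq; apply: eq_bigr => j /(allP P_lt) /= jp.
  rewrite IH; last by lia.
  by rewrite mulrDr !(mulrCA (t ^+ _)).
have := init k; rewrite mem_iota => /(_ kp)/andP[kK /eqP trk].
rewrite !(@rec_seq_init p.+1) //.
have -> : g * t ^+ k = evN r (mulN gb (expN G2 k)).
  by rewrite (evN_mul fps2) (evN_exp fps2) -tE g_bits.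
rewrite (hecke_evN kK) trk (evN_lxor fps2) !(evN_mul fps2) !(evN_comp fps2).
by rewrite -tE -G_bits -g_bits.
Qed.
End Generator.
End Prime.

Section SpanOver.
Variables (K : comNzRingType) (A : comAlgType K) (a : A).

Lemma horner_alg_sum (c : {poly K}) :
  horner_alg a c = \sum_(j < size c) c`_j *: a ^+ j.
Proof.
rewrite -[in LHS](coefK c) poly_def linear_sum; apply: eq_bigr => j _.
by rewrite linearZ rmorphXn /= horner_algX mulr_algl.
Qed.

Lemma horner_alg_evN n : horner_alg a (evN 'X n) = evN a n.
Proof. by rewrite rmorph_evN /= horner_algX. Qed.

Lemma span_mulr (s : seq A) c x :
  x \in span_over a s -> horner_alg a c * x \in span_over a s.
Proof.
move=> /span_overP[d ->]; apply/span_overP; exists (fun i => c * d i).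
by rewrite mulr_sumr; apply: eq_bigr => i _; rewrite rmorphM mulrA.
Qed.

Lemma span_stable (T : {linear A -> A}) (s u : seq A) :
  (forall x k, x \in s -> T (x * a ^+ k) \in span_over a u) ->
  {in span_over a s, forall x, T x \in span_over a u}.
Proof.
move=> Ts _ /span_overP[c ->]; rewrite linear_sum; apply: rpred_sum => i _.
rewrite horner_alg_sum mulr_suml linear_sum; apply: rpred_sum => j _.
rewrite -scalerAl linearZ; apply: rpredZ; rewrite mulrC; apply: Ts.
exact: mem_nth.
Qed.
End SpanOver.

Section QuotientOperator.
Variables (K : comNzRingType) (A : comAlgType K) (a : A) (s u : seq A).
Variable T : {linear A -> A}.
Hypothesis Ts : {in span_over a s, forall x, T x \in span_over a s}.
Hypothesis Tu : {in span_over a u, forall x, T x \in span_over a u}.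

Definition smod_op (x : smod a s) : smod a s := Sub (T (val x)) (Ts (valP x)).

Definition qmod_op (q : qmod a s u) : qmod a s u := qclass u (smod_op (qrepr q)).

Lemma val_smod_op x : val (smod_op x) = T (val x).
Proof. exact: SubK. Qed.

Lemma qmod_op_class x : qmod_op (qclass u x) = qclass u (smod_op x).
Proof.
apply/qclassP; rewrite !val_smod_op -linearB; apply: Tu.
by apply/qclassP; rewrite qreprK.
Qed.

Lemma qclass_linear : linear (@qclass K A a s u).
Proof. by move=> k x y; rewrite qclassD -qscale_class. Qed.

Lemma qmod_op_linear : linear qmod_op.
Proof.
move=> k x y; rewrite -[x]qreprK -[y]qreprK -qclass_linear !qmod_op_class.
rewrite -qclass_linear; apply/qclassP.
have valP l v w : val (l *: v + w : smod a s) = l *: val v + val w by exact: linearP.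
by rewrite !(val_smod_op, valP) linearP subrr rpred0.
Qed.
End QuotientOperator.

Section Generator.
Variables (g : fps 'F_2) (o : nat).
Notation t := (G ^+ 2).
Notation V := (qmod t [:: G; g] [:: G]).

Hypotheses (g_lead : lead o 1 g) (o_lt : (o < 6)%N) (o_mod3 : ~~ (3 %| o)%N).

Lemma span_gE c : horner_alg t c * g \in span_over t [:: G; g].
Proof. by apply/span_mulr/mem_span_over; rewrite !inE eqxx orbT. Qed.

Lemma span_GE c : horner_alg t c * G \in span_over t [:: G].
Proof. by apply/span_mulr/mem_span_over; rewrite !inE. Qed.

Definition gen_smod c : smod t [:: G; g] := Sub (horner_alg t c * g) (span_gE c).
Definition gen_class (c : {poly 'F_2}) : V := qclass [:: G] (gen_smod c).

Lemma val_gen_smod c : val (gen_smod c) = horner_alg t c * g.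
Proof. exact: SubK. Qed.

Lemma gen_class_linear : linear gen_class.
Proof.
move=> k c d; rewrite -qclass_linear; apply/qclassP.
have valP l v w : val (l *: v + w : smod t [:: G; g]) = l *: val v + val w
  by exact: linearP.
rewrite valP !val_gen_smod linearP /= mulr_algl mulrDl scalerAl.
by rewrite subrr rpred0.
Qed.
HB.instance Definition _ :=
  GRing.isLinear.Build 'F_2 {poly 'F_2} V *:%R gen_class gen_class_linear.

Lemma span_pairP x : x \in span_over t [:: G; g] ->
  exists c d, x = horner_alg t c * G + horner_alg t d * g.
Proof.
by case/span_overP => c ->; exists (c 0%N), (c 1%N); rewrite !big_ord_recl big_ord0 addr0.
Qed.

Lemma span_GP x : x \in span_over t [:: G] -> exists c, x = horner_alg t c * G.
Proof.
by case/span_overP => c ->; exists (c 0%N); rewrite !big_ord_recl big_ord0 addr0.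
Qed.

(* G = F(x^3) makes every element of N1 a series in x^3. *)
Lemma span_G_coef x : x \in span_over t [:: G] -> x o = 0.
Proof.
case/span_GP => c ->; rewrite horner_alg_sum mulr_suml fps_coef_sum big1 // => j _.
rewrite -scalerAl -exprM -exprSr -F_pow3 -rmorphXn.
rewrite -[LHS]/(_ * fps_pow 3 _ o) fps_pow_coef (negPf o_mod3).
by rewrite mulr0.
Qed.

Lemma gen_class_surj q : exists c, q = gen_class c.
Proof.
have [c [d cd]] := span_pairP (valP (qrepr q)); exists d.
rewrite -[q]qreprK; apply/qclassP; rewrite val_gen_smod cd addrK.
exact: span_GE.
Qed.

(** The functional lambda. The choice of representative does not matter, since by [span_G_coef] the
    coefficient of x^o vanishes on N1. *)
Definition first_coef (q : V) : 'F_2 := val (qrepr q) o.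

Lemma first_coef_class x : first_coef (qclass [:: G] x) = val x o.
Proof.
apply/eqP; rewrite -subr_eq0 -fps_coefB; apply/eqP/span_G_coef.
by apply/qclassP; rewrite qreprK.
Qed.

Lemma first_coef_linear : scalar first_coef.
Proof.
move=> k x y; rewrite -[x]qreprK -[y]qreprK -qclass_linear !first_coef_class.
have valP l v w : val (l *: v + w : smod t [:: G; g]) = l *: val v + val w
  by exact: linearP.
by rewrite valP.
Qed.
HB.instance Definition _ :=
  GRing.isLinear.Build 'F_2 V 'F_2 *%R first_coef first_coef_linear.

Lemma first_coef_gen k : first_coef (gen_class 'X^k) = (k == 0%N)%:R.
Proof.
rewrite first_coef_class val_gen_smod rmorphXn /= horner_algX -exprM.
have := leadM (leadX (2 * k) G_lead) g_lead.
rewrite expr1n mulr1; case: k => [|k]; first by case.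
by move=> [h _]; apply: h; lia.
Qed.
End Generator.

Lemma fps_horner_evN (K : comNzRingType) (x : fps K) n :
  horner_alg x (evN 'X n) = evN x n.
Proof. exact: horner_alg_evN. Qed.

Lemma weight_interleave i j : (weight i j <= 5 * interleave i j)%N.
Proof.
move: i j; apply: interleave_ind => // i j c d; rewrite interleave_digits /weight.
by case: c d => -[]; lia.
Qed.

Section Adapted.
Variable g : fps 'F_2.
Notation t := (G ^+ 2).
Notation V := (qmod t [:: G; g] [:: G]).

Let e i j : V := gen_class g 'X^(interleave i j).

(** The bound in [low] is weak and that in [filt] strict, hence [D.+1] against [D]. *)
Lemma low_filt D s (f : {poly 'F_2}) : low D.+1 s f -> filt e (s - D) (gen_class g f).
Proof.
move=> lf; rewrite -[f]coefK poly_def linear_sum.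
elim/big_ind: _ => [|u w|k _]; [exact: filt_zero|exact: filtD|].
rewrite linearZ /=; have [i [j ij]] := interleave_surj k.
have [->|nz] := eqVneq f`_k 0; first by rewrite scale0r; apply: filt_zero.
apply: filtZ; rewrite -ij; apply: filt_e.
by have := lf i j; rewrite ij => /(_ nz); lia.
Qed.

Lemma gen_spanning (v : V) : exists s, filt e s v.
Proof.
have [c ->] := gen_class_surj v; exists (5 * size c).+1.
rewrite -[X in filt _ X _]subn0; apply: low_filt => i j nz.
have : (interleave i j < size c)%N.
  by rewrite ltnNge; apply: contra nz => le; rewrite nth_default.
by have := weight_interleave i j; lia.
Qed.

Section Operator.
Variables (T : {linear fps 'F_2 -> fps 'F_2}) (A B A' B' : nat -> N).
Hypothesis Tg : forall k, T (g * t ^+ k) = g * evN t (A k) + G * evN t (B k).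
Hypothesis TG : forall k, T (G * t ^+ k) = G * evN t (A' k) + G * evN t (B' k).

Lemma stable_G : {in span_over t [:: G], forall x, T x \in span_over t [:: G]}.
Proof.
apply: span_stable => x k; rewrite inE => /eqP->; rewrite TG.
by rewrite -!fps_horner_evN; apply: rpredD; rewrite mulrC; apply: span_GE.
Qed.

Lemma stable_g :
  {in span_over t [:: G; g], forall x, T x \in span_over t [:: G; g]}.
Proof.
have sub x : x \in span_over t [:: G] -> x \in span_over t [:: G; g].
  by apply: span_over_sub => z; rewrite !inE => ->.
apply: span_stable => x k; rewrite !inE => /orP[] /eqP->.
  apply/sub; rewrite TG -!fps_horner_evN.
  by apply: rpredD; rewrite mulrC; apply: span_GE.
rewrite Tg -!fps_horner_evN; apply: rpredD; rewrite mulrC; first exact: span_gE.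
exact/sub/span_GE.
Qed.

Definition hecke_quot : V -> V := qmod_op stable_g.
HB.instance Definition _ :=
  GRing.isLinear.Build 'F_2 V V *:%R hecke_quot (qmod_op_linear stable_g stable_G).

Lemma hecke_quot_acts : acts_as T hecke_quot.
Proof.
move=> x; exists (smod_op stable_g x); first exact: val_smod_op.
exact: (qmod_op_class stable_g stable_G).
Qed.

Lemma hecke_quot_gen k : hecke_quot (gen_class g 'X^k) = gen_class g (evN 'X (A k)).
Proof.
rewrite [LHS](qmod_op_class stable_g stable_G); apply/qclassP.
rewrite val_smod_op !val_gen_smod rmorphXn /= horner_algX mulrC Tg.
rewrite -!fps_horner_evN [X in X - _]addrC [g * _]mulrC addrK mulrC.
exact: span_GE.
Qed.

Lemma hecke_quot_lead y i j :
  low (step y).+1 (weight i j) (evN 'X (A (interleave i j)) - lead_term y 2 i j) ->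
  filt e (weight i j - step y)
    (hecke_quot (e i j) - gen_class g (lead_term y 2 i j)).
Proof. by rewrite hecke_quot_gen -linearB; apply: low_filt. Qed.
End Operator.
End Adapted.

Definition lead_check y n P fuel (a : seq N) : bool :=
  let M := build y n P fuel a in
  [&& check_automaton y n P M, (0 < size (states M))%N, nth [::] (states M) 0 == a,
      nth 0%N (types M) 0 == 2%N & nth 0%N (deficits M) 0 == (step y).+1].

Lemma rec_seq_lead y n P fuel a i j :
  (0 < n)%N -> all (fun m => m.2 < n)%N P -> lead_check y n P fuel a ->
  low (step y).+1 (weight i j)
    (evN 'X (rec_seq P a (interleave i j)) - lead_term y 2 i j).
Proof.
move=> n_gt0 P_lt /and5P[ok M0 /eqP aE /eqP tyE /eqP defE].
by have := @automaton_lead _ _ _ _ n_gt0 P_lt ok i j _ M0; rewrite aE tyE defE.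
Qed.

(* T_p(g t^k) = g a_k(t) + G b_k(t) for k <= p, with t = G^2: the lists a and b
   are Fp and Fp' for g = F, Hp and Hp' for g = F^2 G, Gp and 0 for g = G. *)
Definition F7 : seq N := [:: 0; 1; 0; 4; 2; 16; 8; 64]%num.
Definition F7' : seq N := [:: 0; 0; 1; 0; 0; 0; 16; 8]%num.
Definition H7 : seq N := [:: 0; 1; 0; 4; 2; 17; 8; 68]%num.
Definition H7' : seq N := [:: 1; 0; 4; 2; 16; 8; 64; 2]%num.
Definition G7 : seq N := [:: 0; 0; 0; 1; 0; 0; 2; 16]%num.
Definition F13 : seq N :=
  [:: 0; 0; 1; 2; 0; 0; 16; 32; 4; 8; 272; 546; 64; 136]%num.
Definition F13' : seq N := [:: 0; 0; 0; 0; 0; 1; 2; 0; 0; 0; 0; 0; 8; 272]%num.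
Definition H13 : seq N :=
  [:: 0; 0; 1; 2; 0; 0; 17; 34; 4; 8; 273; 546; 68; 128]%num.
Definition H13' : seq N :=
  [:: 0; 0; 0; 1; 2; 4; 8; 0; 0; 4; 8; 256; 514; 1088]%num.
Definition G13 : seq N :=
  [:: 0; 0; 1; 2; 0; 0; 17; 32; 4; 8; 272; 546; 64; 128]%num.

Definition Hbits : N := mulN (expN Fbits 2) Gbits.

(** The table length 64 exceeds the degree 4 + 56 of F t^7 in r. Likewise 72, 112 and 120 exceed 12
    + 56, 4 + 104 and 12 + 104. *)
Lemma initial_F7 : initial_check 7 R7 Fbits 64 F7 F7'.
Proof. by vm_compute. Qed.
Lemma initial_H7 : initial_check 7 R7 Hbits 72 H7 H7'.
Proof. by vm_compute. Qed.
Lemma initial_G7 : initial_check 7 R7 Gbits 64 G7 (nseq 8 0%num).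
Proof. by vm_compute. Qed.
Lemma initial_F13 : initial_check 13 R13 Fbits 112 F13 F13'.
Proof. by vm_compute. Qed.
Lemma initial_H13 : initial_check 13 R13 Hbits 120 H13 H13'.
Proof. by vm_compute. Qed.
Lemma initial_G13 : initial_check 13 R13 Gbits 112 G13 (nseq 14 0%num).
Proof. by vm_compute. Qed.

(** [400] is fuel for the search of states; the check includes that transitions stay within the list
    found. *)
Lemma lead_F7 : lead_check false 8 P7 400 F7. Proof. by vm_compute. Qed.
Lemma lead_H7 : lead_check false 8 P7 400 H7. Proof. by vm_compute. Qed.
Lemma lead_F13 : lead_check true 14 P13 400 F13. Proof. by vm_compute. Qed.
Lemma lead_H13 : lead_check true 14 P13 400 H13. Proof. by vm_compute. Qed.

Section QuotientBasis.
Variables (g : fps 'F_2) (o : nat).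
Notation t := (G ^+ 2).
Hypotheses (g_lead : lead o 1 g) (o_lt : (o < 6)%N) (o_mod3 : ~~ (3 %| o)%N).
Variables (T1 T2 : {linear fps 'F_2 -> fps 'F_2}).
Variables (A1 B1 A1' B1' A2 B2 A2' B2' : nat -> N).
Hypothesis Tg1 : forall k, T1 (g * t ^+ k) = g * evN t (A1 k) + G * evN t (B1 k).
Hypothesis TG1 : forall k, T1 (G * t ^+ k) = G * evN t (A1' k) + G * evN t (B1' k).
Hypothesis Tg2 : forall k, T2 (g * t ^+ k) = g * evN t (A2 k) + G * evN t (B2 k).
Hypothesis TG2 : forall k, T2 (G * t ^+ k) = G * evN t (A2' k) + G * evN t (B2' k).
Hypothesis T12 : forall f, T1 (T2 f) = T2 (T1 f).
Hypothesis T1_lead : forall i j, low (step false).+1 (weight i j)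
  (evN 'X (A1 (interleave i j)) - lead_term false 2 i j).
Hypothesis T2_lead : forall i j, low (step true).+1 (weight i j)
  (evN 'X (A2 (interleave i j)) - lead_term true 2 i j).

Lemma hecke_quotC q :
  hecke_quot Tg1 TG1 (hecke_quot Tg2 TG2 q) = hecke_quot Tg2 TG2 (hecke_quot Tg1 TG1 q).
Proof.
rewrite -[q]qreprK /hecke_quot.
rewrite (qmod_op_class (stable_g Tg1 TG1) (stable_G TG1)).
rewrite (qmod_op_class (stable_g Tg2 TG2) (stable_G TG2)).
rewrite (qmod_op_class (stable_g Tg1 TG1) (stable_G TG1)).
rewrite (qmod_op_class (stable_g Tg2 TG2) (stable_G TG2)).
by congr (qclass _ _); apply: val_inj; rewrite !val_smod_op T12.
Qed.

Lemma quotient_basis : exists m : nat -> nat -> qmod t [:: G; g] [:: G],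
  adapted_basis (hecke_quot Tg1 TG1) (hecke_quot Tg2 TG2) m /\
  m 0%N 0%N = gen_class g 1.
Proof.
pose e i j := gen_class g 'X^(interleave i j).
have lam_e a b : first_coef o (e a b) = ((a == 0%N) && (b == 0%N))%:R.
  rewrite first_coef_gen //; congr ((nat_of_bool _)%:R); apply/eqP/andP.
    by move=> /(@interleave_inj a b 0 0)[-> ->].
  by case=> /eqP-> /eqP->.
have l1 a b : filt e (weight a b - 2)
    (hecke_quot Tg1 TG1 (e a b) - if a is a'.+1 then e a' b else 0).
  have := hecke_quot_lead Tg1 TG1 (@T1_lead a b); rewrite /lead_term /=.
  by case: a => [|a] //; rewrite linear0.
have l2 a b : filt e (weight a b - 3)
    (hecke_quot Tg2 TG2 (e a b) - if b is b'.+1 then e a b' else 0).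
  have := hecke_quot_lead Tg2 TG2 (@T2_lead a b); rewrite /lead_term /=.
  by case: b => [|b] //; rewrite linear0.
have := triangular_adapted hecke_quotC (@gen_spanning g) lam_e l1 l2.
by move=> /(_ o_mod3)[m mb]; exists m.
Qed.
End QuotientBasis.

Lemma F2G_bits : F ^+ 2 * G = evN r Hbits.
Proof. by rewrite (evN_mul fps2) (evN_exp fps2) -F_bits -G_bits. Qed.

Lemma F2G_lead : lead 5 1 (F ^+ 2 * G).
Proof. by have := leadM (leadX 2 F_lead) G_lead; rewrite expr1n mulr1. Qed.

Notation symmetric_list n l :=
  (perm_eq ((0%N, n) :: l) [seq (m.2, m.1) | m <- (0%N, n) :: l]).

Lemma R7_sym : symmetric_list 8%N R7. Proof. by vm_compute. Qed.
Lemma P7_sym : symmetric_list 8%N P7. Proof. by vm_compute. Qed.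
Lemma R13_sym : symmetric_list 14%N R13. Proof. by vm_compute. Qed.
Lemma P13_sym : symmetric_list 14%N P13. Proof. by vm_compute. Qed.

Lemma hecke7_generator gb K a b (g : fps 'F_2) : g = evN r gb ->
  initial_check 7 R7 gb K a b -> forall k,
  hecke 7 (g * (G ^+ 2) ^+ k) =
  g * evN (G ^+ 2) (rec_seq P7 a k) + G * evN (G ^+ 2) (rec_seq P7 b k).
Proof.
apply: (hecke_generator (p := 7) isT isT R7_sym P7_sym isT isT modular_check7).
Qed.

Lemma hecke13_generator gb K a b (g : fps 'F_2) : g = evN r gb ->
  initial_check 13 R13 gb K a b -> forall k,
  hecke 13 (g * (G ^+ 2) ^+ k) =
  g * evN (G ^+ 2) (rec_seq P13 a k) + G * evN (G ^+ 2) (rec_seq P13 b k).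
Proof.
apply: (hecke_generator (p := 13) isT isT R13_sym P13_sym isT isT modular_check13).
Qed.

Lemma low_F7 i j : low (step false).+1 (weight i j)
  (evN 'X (rec_seq P7 F7 (interleave i j)) - lead_term false 2 i j).
Proof. apply: (@rec_seq_lead false 8 P7 400 F7 i j isT isT lead_F7). Qed.

Lemma low_H7 i j : low (step false).+1 (weight i j)
  (evN 'X (rec_seq P7 H7 (interleave i j)) - lead_term false 2 i j).
Proof. apply: (@rec_seq_lead false 8 P7 400 H7 i j isT isT lead_H7). Qed.

Lemma low_F13 i j : low (step true).+1 (weight i j)
  (evN 'X (rec_seq P13 F13 (interleave i j)) - lead_term true 2 i j).
Proof. apply: (@rec_seq_lead true 14 P13 400 F13 i j isT isT lead_F13). Qed.

Lemma low_H13 i j : low (step true).+1 (weight i j)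
  (evN 'X (rec_seq P13 H13 (interleave i j)) - lead_term true 2 i j).
Proof. apply: (@rec_seq_lead true 14 P13 400 H13 i j isT isT lead_H13). Qed.

Lemma gen_class1 g (gs : g \in span_over (G ^+ 2) [:: G; g]) :
  gen_class g 1 = qclass [:: G] (Sub g gs : smod (G ^+ 2) [:: G; g]).
Proof. by apply/qclassP; rewrite val_gen_smod rmorph1 mul1r SubK subrr rpred0. Qed.

Local Close Scope ring_scope.

Theorem theorem4p13 :
  (exists X Y : {linear K1modN1 -> K1modN1},
     acts_as (hecke 7) X /\ acts_as (hecke 13) Y /\
     exists m : nat -> nat -> K1modN1,
       adapted_basis X Y m /\ m 0 0 = classF)
  /\
  (exists X Y : {linear K5modN1 -> K5modN1},
     acts_as (hecke 7) X /\ acts_as (hecke 13) Y /\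
     exists m : nat -> nat -> K5modN1,
       adapted_basis X Y m /\ m 0 0 = classF2G).
Proof.
have T12 f : hecke 7 (hecke 13 f) = hecke 13 (hecke 7 f) by exact: heckeC.
have TG7 := hecke7_generator G_bits initial_G7.
have TG13 := hecke13_generator G_bits initial_G13.
split.
- have Tg7 := hecke7_generator F_bits initial_F7.
  have Tg13 := hecke13_generator F_bits initial_F13.
  have [m [mb m0]] :=
    quotient_basis F_lead isT isT Tg7 TG7 Tg13 TG13 T12 low_F7 low_F13.
  exists (hecke_quot (T := hecke 7) Tg7 TG7), (hecke_quot (T := hecke 13) Tg13 TG13).
  split; first exact: hecke_quot_acts.
  split; first exact: hecke_quot_acts.
  exists m; split; first exact: mb.
  by apply: (etrans m0); apply: gen_class1.
have Tg7 := hecke7_generator F2G_bits initial_H7.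
have Tg13 := hecke13_generator F2G_bits initial_H13.
have [m [mb m0]] :=
  quotient_basis F2G_lead isT isT Tg7 TG7 Tg13 TG13 T12 low_H7 low_H13.
exists (hecke_quot (T := hecke 7) Tg7 TG7), (hecke_quot (T := hecke 13) Tg13 TG13).
split; first exact: hecke_quot_acts.
split; first exact: hecke_quot_acts.
exists m; split; first exact: mb.
by apply: (etrans m0); apply: gen_class1.
Qed.
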